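(* There exists an invariant bond percolation process on the slab graph $\mathbb{Z}^2 \times \{0,1\}$ which, almost surely, has infinitely many robust clusters.
   Context: The slab $\mathbb{Z}^2\times\{0,1\}$ is the graph with vertex set $\mathbb{Z}^2\times\{0,1\}$, two vertices being adjacent iff they differ by $1$ in exactly one coordinate (so it consists of two copies of the square lattice $\mathbb{Z}^2$ joined by vertical edges between corresponding vertices). An invariant bond percolation process on a graph $G$ is a random subset of the edge set of $G$ whose distribution is invariant under all graph automorphisms of $G$. The clusters of the process are the connected components of the random subgraph formed by the retained edges. A cluster $C$ is called robust if its critical percolation probability is strictly less than $1$, i.e. there is $\epsilon>0$ such that if each edge of $C$ is deleted independently with probability $\epsilon$, then with positive probability the remaining subgraph of $C$ still has an infinite connected component. *)

(* Defs.v *)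
From HB Require Import structures.
From mathcomp Require Import all_boot all_order all_algebra.
From mathcomp Require Import all_classical all_reals all_analysis.
From Stdlib Require Relation_Operators List.
Set Implicit Arguments. Unset Strict Implicit. Unset Printing Implicit Defensive.
Import Order.TTheory GRing.Theory Num.Theory.
Local Open Scope classical_set_scope.
Local Open Scope ring_scope.

Definition V : Type := (int * int * bool)%type.

Definition adj (u v : V) : Prop :=
  let: (a, b, i) := u in let: (c, d, j) := v in
  [/\ `|a - c| = 1, b = d & i = j] \/
  [/\ a = c, `|b - d| = 1 & i = j] \/
  [/\ a = c, b = d & i <> j].

Definition pair_set (x y : V) : set V := [set z | z = x \/ z = y].

Definition Edge : Type := {S : set V | exists x y, adj x y /\ S = pair_set x y}.

Record aut := Aut {
  af : V -> V;
  ainv : V -> V;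
  af_K : cancel af ainv;
  ainv_K : cancel ainv af;
  af_adj : forall x y, adj (af x) (af y) <-> adj x y }.

Lemma ainv_adj (f : aut) x y : adj (ainv f x) (ainv f y) <-> adj x y.
Proof.
have := af_adj f (ainv f x) (ainv f y); rewrite !ainv_K => h; tauto.
Qed.

Lemma image_pair_set (g : V -> V) x y : g @` pair_set x y = pair_set (g x) (g y).
Proof.
apply/seteqP; split=> z.
  by case=> w [->|->] <-; [left|right].
by case=> ->; [exists x; [left|] | exists y; [right|]].
Qed.

Lemma edge_image_proof (g : V -> V) (hg : forall x y, adj x y -> adj (g x) (g y))
  (S : set V) : (exists x y, adj x y /\ S = pair_set x y) ->
  exists x y, adj x y /\ g @` S = pair_set x y.
Proof.
case=> x [y [hxy ->]]; exists (g x), (g y); split; first exact: hg.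
exact: image_pair_set.
Qed.

Definition edge_inv (f : aut) (e : Edge) : Edge :=
  exist _ (ainv f @` proj1_sig e)
    (@edge_image_proof (ainv f) (fun x y => proj2 (ainv_adj f x y)) _ (proj2_sig e)).

(* Configurations: the indicator of the set of retained edges. *)
Definition cylinders : set (set (Edge -> bool)) :=
  [set A | exists (e : Edge) (b : bool), A = [set w | w e = b]].

Definition Omega : Type := g_sigma_algebraType cylinders.

(* Action of an automorphism f on configurations: the image of the
   retained edge set X under f, i.e. e is retained in f(X) iff f^-1(e) is in X. *)
Definition aut_act (f : aut) (w : Omega) : Omega := fun e => w (edge_inv f e).

Definition aut_invariant {R : realType} (P : probability Omega R) : Prop :=
  forall f : aut, forall A : set Omega, measurable A ->
    P (aut_act f @^-1` A) = P A.

Definition open_adj (w : Edge -> bool) (x y : V) : Prop :=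
  exists e : Edge, w e /\ proj1_sig e = pair_set x y.

Definition open_connected (w : Edge -> bool) : V -> V -> Prop :=
  Relation_Operators.clos_refl_trans V (open_adj w).

Definition cluster_of (w : Edge -> bool) (x : V) : set V := [set y | open_connected w x y].
Definition is_cluster (w : Edge -> bool) (C : set V) : Prop :=
  exists x, C = cluster_of w x.

(* Bernoulli bond percolation with retention parameter p on all edges of the
   slab, characterized by its finite-dimensional (cylinder) marginals;
   such a probability is unique on the product sigma-algebra. *)
Definition bernoulli_product {R : realType} (p : R) (Q : probability Omega R) : Prop :=
  forall (es : seq Edge) (b : Edge -> bool), List.NoDup es ->
    Q [set w : Omega | forall e, List.In e es -> w e = b e]
    = (\prod_(e <- es) (if b e then p else 1 - p))%:E.

Definition cluster_edges (w : Edge -> bool) (C : set V) (e : Edge) : bool :=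
  w e && `[< proj1_sig e `<=` C >].

Definition robust {R : realType} (w : Edge -> bool) (C : set V) : Prop :=
  exists eps : R, 0 < eps <= 1 /\
  exists Q : probability Omega R, bernoulli_product (1 - eps) Q /\
    (0 < Q [set eta : Omega | exists x, C x /\
        infinite_set (cluster_of (fun e => cluster_edges w C e && eta e) x)])%E.

(* Main.v *)
Require Import Defs.
From HB Require Import structures.
From mathcomp Require Import all_boot all_order all_algebra.
From mathcomp Require Import all_classical all_reals all_analysis.
From mathcomp Require Import measurable_realfun.
From mathcomp Require Import zify ring lra.
From Stdlib Require Operators_Properties.
Set Implicit Arguments. Unset Strict Implicit. Unset Printing Implicit Defensive.
Import Order.TTheory GRing.Theory Num.Theory.
Import numFieldNormedType.Exports.
Local Open Scope classical_set_scope.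
Local Open Scope ring_scope.

(** Colour every row and every column of Z^2 by the 2-adic valuation of its
coordinate, shifted by a uniformly random 2-adic integer (one shift for the
rows, an independent one for the columns).  One layer, chosen by a fair coin,
keeps all its horizontal lines, the other layer all its vertical lines, and a
rung is kept iff its row and its column have the same colour.  As rows and
columns live in different layers, crossings of different colours do not
interact: the cluster of colour k consists of the rows and columns of colour k
and contains a copy of Z^2 with every edge subdivided into 2^(k+1) edges, so it
is robust.

Robustness is a multi-scale argument.  A node of the subdivided lattice is good
if the edges it owns are open, and a box of side 3^(k+1) is good if at most one
of its nine sub-boxes is bad.  Adjacent good boxes have connected giant
components, while a bad box of side 3^k forces 2^k closed edges chosen among at
most C^(2^k) lists, so that it has probability at most (C eps)^(2^k).

Automorphisms of the slab map straight lines to straight lines, hence act on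
rows and columns through isometries of Z.  Truncated at level N, the
configuration is a function of a coin and of two uniform residues modulo 2^N,
whose law is preserved by these isometries; invariance follows as N grows. *)

(** * Good boxes *)

(** At most one bad cell among nine, phrased on pairs so that its negation directly yields two
    distinct bad cells. *)
Definition block (G : nat -> nat -> Prop) (p q : nat) : Prop :=
  forall i j i' j', (i < 3)%N -> (j < 3)%N -> (i' < 3)%N -> (j' < 3)%N ->
    (i, j) != (i', j') ->
    G (3 * p + i)%N (3 * q + j)%N \/ G (3 * p + i')%N (3 * q + j')%N.

(** Equality is included because two points of one box must be compared as well; left and down
    neighbours come from symmetry. *)
Definition near (p q p' q' : nat) : Prop :=
  [\/ p' = p /\ q' = q, p' = p.+1 /\ q' = q | p' = p /\ q' = q.+1].

Lemma block_exception (G : nat -> nat -> Prop) p q : block G p q ->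
  exists i0 j0, forall i j, (i < 3)%N -> (j < 3)%N ->
    i != i0 \/ j != j0 -> G (3 * p + i)%N (3 * q + j)%N.
Proof.
move=> bG.
have [[i0 [j0 [hi [hj ng]]]]|allg] := pselect (exists i j, (i < 3)%N /\ (j < 3)%N /\
  ~ G (3 * p + i)%N (3 * q + j)%N).
  exists i0, j0 => i j ilt jlt ne; case: (bG i j i0 j0) => //.
  by apply/eqP => -[ii jj]; case: ne; rewrite ?ii ?jj eqxx.
exists 0, 0 => i j ilt jlt _; apply: contrapT => ng; apply: allg.
by exists i, j.
Qed.

Section BlockConn.
Variables (G : nat -> nat -> Prop) (D : nat * nat -> nat * nat -> Prop).
Hypothesis Dsym : forall a b, D a b -> D b a.
Hypothesis Dtrans : forall a b c, D a b -> D b c -> D a c.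
Hypothesis Dnear : forall p q p' q', G p q -> G p' q' -> near p q p' q' ->
  D (p, q) (p', q').

Let rowup y a n : (forall x, (a <= x <= a + n)%N -> G x y) -> D (a, y) ((a + n)%N, y).
Proof.
elim: n => [|n IH] h.
  by rewrite addn0; apply: Dnear; [apply: h; lia|apply: h; lia|constructor 1].
apply: (@Dtrans _ ((a + n)%N, y)); first by apply: IH => x hx; apply: h; lia.
by apply: Dnear; [apply: h; lia|apply: h; lia|constructor 2; rewrite addnS].
Qed.

Let colup x a n : (forall y, (a <= y <= a + n)%N -> G x y) -> D (x, a) (x, (a + n)%N).
Proof.
elim: n => [|n IH] h.
  by rewrite addn0; apply: Dnear; [apply: h; lia|apply: h; lia|constructor 1].
apply: (@Dtrans _ (x, (a + n)%N)); first by apply: IH => y hy; apply: h; lia.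
by apply: Dnear; [apply: h; lia|apply: h; lia|constructor 3; rewrite addnS].
Qed.

Let row y a b lo hi : (forall x, (lo <= x < hi)%N -> G x y) ->
  (lo <= a < hi)%N -> (lo <= b < hi)%N -> D (a, y) (b, y).
Proof.
move=> h ha hb; have [ab|ba] := leqP a b.
  by rewrite -(subnKC ab); apply: rowup => x hx; apply: h; lia.
by apply: Dsym; rewrite -(subnKC (ltnW ba)); apply: rowup => x hx; apply: h; lia.
Qed.

Let col x a b lo hi : (forall y, (lo <= y < hi)%N -> G x y) ->
  (lo <= a < hi)%N -> (lo <= b < hi)%N -> D (x, a) (x, b).
Proof.
move=> h ha hb; have [ab|ba] := leqP a b.
  by rewrite -(subnKC ab); apply: colup => y hy; apply: h; lia.
by apply: Dsym; rewrite -(subnKC (ltnW ba)); apply: colup => y hy; apply: h; lia.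
Qed.

(* A good cell is joined to any cell whose row and column both avoid the
   exceptional cell: use its own column if that avoids the exception, and its
   own row otherwise. *)
Let hub p q i0 j0 i j c r :
  (forall i j, (i < 3)%N -> (j < 3)%N ->
    i != i0 \/ j != j0 -> G (3 * p + i)%N (3 * q + j)%N) ->
  (i < 3)%N -> (j < 3)%N -> (c < 3)%N -> (r < 3)%N -> c != i0 -> r != j0 ->
  G (3 * p + i)%N (3 * q + j)%N ->
  D ((3 * p + i)%N, (3 * q + j)%N) ((3 * p + c)%N, (3 * q + r)%N).
Proof.
move=> hG hi hj hc hr ci rj gij.
have colG x : (x < 3)%N -> x != i0 -> forall y, (3 * q <= y < 3 * q + 3)%N -> G (3 * p + x)%N y.
  by move=> x3 xi y hy; rewrite -(@subnKC (3 * q) y); [apply: hG => //; [lia|left]|lia].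
have [ii|ii] := eqVneq i i0.
  apply: (@Dtrans _ ((3 * p + c)%N, (3 * q + j)%N)).
    apply: (@row _ _ _ (3 * p) (3 * p + 3)); [|lia..] => x hx.
    have [->//|nx] := eqVneq x (3 * p + i)%N.
    by rewrite -(@subnKC (3 * p) x); [apply: hG => //; [lia|left; lia]|lia].
  by apply: (@col _ _ _ (3 * q) (3 * q + 3)); [exact: colG|lia..].
apply: (@Dtrans _ ((3 * p + i)%N, (3 * q + r)%N)).
  by apply: (@col _ _ _ (3 * q) (3 * q + 3)); [exact: colG|lia..].
apply: (@row _ _ _ (3 * p) (3 * p + 3)); [|lia..] => x hx.
by rewrite -(@subnKC (3 * p) x); [apply: hG => //; [lia|right]|lia].
Qed.

Lemma block_conn p q p' q' i j i' j' : block G p q -> block G p' q' ->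
  near p q p' q' ->
  (i < 3)%N -> (j < 3)%N -> (i' < 3)%N -> (j' < 3)%N ->
  G (3 * p + i)%N (3 * q + j)%N -> G (3 * p' + i')%N (3 * q' + j')%N ->
  D ((3 * p + i)%N, (3 * q + j)%N) ((3 * p' + i')%N, (3 * q' + j')%N).
Proof.
have other3 (a b : nat) : exists c, [/\ (c < 3)%N, c != a & c != b].
  have /orP[/andP[]|/orP[/andP[]|/andP[]]] :
      ((0 != a) && (0 != b) || ((1 != a) && (1 != b) || (2 != a) && (2 != b)))%N by lia.
  - by exists 0.
  - by exists 1.
  - by exists 2.
move=> /block_exception[i0 [j0 e]] /block_exception[i1 [j1 e']] nr hi hj hi' hj' g g'.
(* Three columns and three rows leave one of each that avoids the exceptional cells of both blocks;
   the cells [(c, r)] of the two blocks are then joined along row [r] or column [c]. *)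
have [c [c3 ci0 ci1]] := other3 i0 i1; have [r [r3 rj0 rj1]] := other3 j0 j1.
have h := hub e hi hj c3 r3 ci0 rj0 g.
have h' := Dsym (hub e' hi' hj' c3 r3 ci1 rj1 g').
apply: (Dtrans h); apply: Dtrans h'.
case: nr => -[-> ->] in e' g' *.
- by apply: Dnear; [apply: e => //; left|apply: e => //; left|constructor 1].
- apply: (@row _ _ _ (3 * p) (3 * p + 6)); [|lia..] => x hx.
  have [xl|xl] := ltnP x (3 * p + 3).
    by rewrite -(@subnKC (3 * p) x); [apply: e => //; [lia|right]|lia].
  by rewrite -(@subnKC (3 * p.+1) x); [apply: e' => //; [lia|right]|lia].
- apply: (@col _ _ _ (3 * q) (3 * q + 6)); [|lia..] => y hy.
  have [yl|yl] := ltnP y (3 * q + 3).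
    by rewrite -(@subnKC (3 * q) y); [apply: e => //; [lia|left]|lia].
  by rewrite -(@subnKC (3 * q.+1) y); [apply: e' => //; [lia|left]|lia].
Qed.

End BlockConn.

Fixpoint gbox (g : nat -> nat -> Prop) (k : nat) : nat -> nat -> Prop :=
  if k is k'.+1 then block (gbox g k') else g.

(** The nodes reached by descending through good sub-boxes only; in a good box they turn out to be
    connected to each other. *)
Fixpoint giant (g : nat -> nat -> Prop) (k p q : nat) : set (nat * nat) :=
  if k is k'.+1 then
    [set v | exists i j, [/\ (i < 3)%N, (j < 3)%N,
       gbox g k' (3 * p + i) (3 * q + j) & giant g k' (3 * p + i) (3 * q + j) v]]
  else [set (p, q)].

Lemma giant_neq0 g k p q : gbox g k p q -> exists v, giant g k p q v.
Proof.
elim: k p q => [|k IH] p q /=; first by exists (p, q).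
move=> /block_exception[i0 [j0 h]].
pose i := (if i0 == 0 then 1 else 0)%N.
have i3 : (i < 3)%N by rewrite /i; case: ifP.
have gi : gbox g k (3 * p + i) (3 * q + 0).
  by apply: h => //; left; rewrite /i; case: ifP; lia.
by have [v gv] := IH _ _ gi; exists v, i, 0.
Qed.

Lemma giant_good g k p q v : gbox g k p q -> giant g k p q v -> g v.1 v.2.
Proof.
elim: k p q => [|k IH] p q /=; first by move=> ? ->.
by move=> _ [i [j [_ _ gk gv]]]; exact: IH gk gv.
Qed.

Lemma giant_bound g k p q v : giant g k p q v ->
  (3 ^ k * p <= v.1)%N /\ (3 ^ k * q <= v.2)%N.
Proof.
elim: k p q => [|k IH] p q /=; first by move=> ->; rewrite !expn0 !mul1n.
move=> [i [j [_ _ _ /IH[h1 h2]]]]; rewrite !expnSr -!mulnA; split.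
  by apply: leq_trans h1; rewrite leq_mul2l leq_addr orbT.
by apply: leq_trans h2; rewrite leq_mul2l leq_addr orbT.
Qed.

Lemma giant_conn (g : nat -> nat -> Prop) (conn : nat * nat -> nat * nat -> Prop)
  (csym : forall a b, conn a b -> conn b a)
  (ctrans : forall a b c, conn a b -> conn b c -> conn a c)
  (cnear : forall p q p' q', g p q -> g p' q' -> near p q p' q' ->
     conn (p, q) (p', q')) k p q p' q' u v :
  gbox g k p q -> gbox g k p' q' -> near p q p' q' ->
  giant g k p q u -> giant g k p' q' v -> conn u v.
Proof.
elim: k p q p' q' u v => [|k IH] p q p' q' u v /=.
  by move=> gp gp' nr -> ->; exact: cnear.
move=> bp bp' nr [i [j [i3 j3 gij uij]]] [i' [j' [i3' j3' gij' vij]]].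
(* [D] carries the goodness of its cells so that transitivity can pass through a point of the
   non-empty giant of the middle cell. *)
pose D (a b : nat * nat) := [/\ gbox g k a.1 a.2, gbox g k b.1 b.2 &
  forall u v, giant g k a.1 a.2 u -> giant g k b.1 b.2 v -> conn u v].
have [] // : D ((3 * p + i)%N, (3 * q + j)%N) ((3 * p' + i')%N, (3 * q' + j')%N).
  apply: (@block_conn (gbox g k)) => //.
  - by move=> a b [ga gb h]; split=> // x y xb ya; apply: csym; exact: h.
  - move=> a b c [ga gb h] [_ gc h']; split=> // x y xa yc.
    by have [w wb] := giant_neq0 gb; exact: ctrans (h _ _ xa wb) (h' _ _ wb yc).
  - by move=> a b a' b' ga gb near_ab; split=> //= x y xa yb; exact: IH near_ab xa yb.
by move=> _ _; apply.
Qed.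

(** When all boxes at the origin are good, the origin lies in the giant of each of them, and these
    giants reach arbitrarily far. *)
Lemma gbox_infinite (g : nat -> nat -> Prop) (conn : nat * nat -> nat * nat -> Prop)
  (csym : forall a b, conn a b -> conn b a)
  (ctrans : forall a b c, conn a b -> conn b c -> conn a c)
  (cnear : forall p q p' q', g p q -> g p' q' -> near p q p' q' ->
     conn (p, q) (p', q')) :
  (forall k, gbox g k 0 0) ->
  forall n, exists v, [/\ (n <= v.1 + v.2)%N, g v.1 v.2 & conn (0, 0)%N v].
Proof.
move=> gk n.
have m0 k : giant g k 0 0 (0, 0)%N.
  by elim: k => //= k IH; exists 0, 0; split=> //; exact: gk.
(* Of the cells [(0, 1)] and [(1, 0)] of the box of level [n.+1] one is good, and its giant is at
   distance at least [3 ^ n] from the origin. *)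
have /(_ 0 1 1 0)%N := gk n.+1.
suff H i j : (i < 3)%N -> (j < 3)%N -> (0 < i + j)%N -> gbox g n (3 * 0 + i) (3 * 0 + j) ->
    exists v, [/\ (n <= v.1 + v.2)%N, g v.1 v.2 & conn (0, 0)%N v].
  by case=> // gij; apply: (H _ _ _ _ _ gij).
move=> i3 j3 ij gij.
have [v gv] := giant_neq0 gij; exists v; split.
- have [h1 h2] := giant_bound gv.
  have h3 : (n < 3 ^ n)%N by exact: ltn_expl.
  have : (3 ^ n * 1 <= 3 ^ n * (3 * 0 + i) + 3 ^ n * (3 * 0 + j))%N.
    by rewrite -mulnDr leq_mul2l; apply/orP; right; lia.
  by lia.
- exact: giant_good gij gv.
- apply: (@giant_conn g conn csym ctrans cnear n.+1 0 0 0 0 _ _ (gk _) (gk _)).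
  + by constructor 1.
  + exact: m0.
  + by exists i, j.
Qed.

(** * Bernoulli percolation from binary expansions *)

Definition unit_lebesgue (R : realType) : set (measurableTypeR R) -> \bar R :=
  mrestr (@lebesgue_measure R) (measurable_itv `[0, 1[).

HB.instance Definition _ (R : realType) :=
  Measure.copy (@unit_lebesgue R) (mrestr (@lebesgue_measure R) (measurable_itv `[0, 1[)).

Lemma unit_lebesgue_setT (R : realType) : @unit_lebesgue R setT = 1%E.
Proof.
by rewrite /unit_lebesgue /mrestr setTI lebesgue_measure_itv/= lte_fin ltr01 oppr0 adde0.
Qed.

HB.instance Definition _ (R : realType) :=
  Measure_isProbability.Build _ _ _ (@unit_lebesgue R) (unit_lebesgue_setT R).

(** The expanding map of the unit interval with full affine branches on [[0, p[] and [[p, 1[]. Under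
    Lebesgue measure its itinerary, read by [digit], is a sequence of independent Bernoulli bits of
    parameter [p]. *)
Definition cut (R : realType) (p r : R) : R :=
  if r < p then r / p else (r - p) / (1 - p).

Definition digit (R : realType) (p : R) (k : nat) (r : R) : bool :=
  iter k (cut p) r < p.

Lemma measurable_cut (R : realType) (p : R) : measurable_fun setT (cut p).
Proof.
apply: measurable_fun_if => //=; first exact: measurable_fun_ltr.
  by apply: measurable_funTS; apply: measurable_funM.
by apply: measurable_funTS; apply: measurable_funM => //; apply: measurable_funB.
Qed.

Lemma measurable_digit (R : realType) (p : R) k b :
  measurable [set r | digit p k r = b].
Proof.
have mk : measurable_fun setT (iter k (cut p)).
  elim: k => [|k IH]; first exact: measurable_id.
  exact: (measurableT_comp (measurable_cut p) IH).
have md : measurable_fun setT (digit p k) by exact: measurable_fun_ltr.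
by have := md measurableT [set b]; rewrite setTI; apply.
Qed.

Definition weight (R : realType) (p : R) (b : bool) : R := if b then p else 1 - p.

(** Induction from the front of the list: one more leading digit pulls the interval back through a
    branch of [cut], which scales its length by [p] or [1 - p]. *)
Lemma cylinder_itv (R : realType) (p : R) (bs : seq bool) : 0 < p < 1 ->
  exists lo hi : R, [/\ 0 <= lo, lo <= hi, hi <= 1, hi - lo = \prod_(b <- bs) weight p b &
    forall r, 0 <= r < 1 ->
      ((forall k, (k < size bs)%N -> digit p k r = nth false bs k) <-> lo <= r < hi)].
Proof.
move=> /andP[p0 p1]; have q0 : 0 < 1 - p by lra.
elim: bs => [|b bs [lo [hi [lo0 lohi hi1 hilo IH]]]].
  by exists 0, 1; split; rewrite ?big_nil ?subr0.
have cons_digit r : 0 <= r < 1 ->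
    ((forall k, (k < size (b :: bs))%N -> digit p k r = nth false (b :: bs) k) <->
     ((r < p) = b /\ lo <= cut p r < hi)).
  move=> r01; have c01 : 0 <= cut p r < 1.
    rewrite /cut; case: ltP => rp; rewrite ?divr_ge0 ?ltr_pdivrMr//; lra.
  rewrite -IH//; split=> [h|[h1 h2] [|k]//= kn].
    split; first by have := h 0%N; apply.
    by move=> k kn; have := h k.+1 kn; rewrite /digit iterSr.
  by have := h2 k kn; rewrite /digit iterSr.
have ple : p * lo <= p * hi by rewrite ler_wpM2l// ltW.
have qle : (1 - p) * lo <= (1 - p) * hi by rewrite ler_wpM2l// ltW.
have plo : 0 <= p * lo by rewrite mulr_ge0// ltW.
have qlo : 0 <= (1 - p) * lo by rewrite mulr_ge0// ltW.
have phi : p * hi <= p by rewrite ger_pMr.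
have qhi : (1 - p) * hi <= 1 - p by rewrite ger_pMr.
case: b cons_digit => cons_digit; [exists (p * lo), (p * hi)|
    exists (p + (1 - p) * lo), (p + (1 - p) * hi)]; (split; [lra|lra|lra|
  by rewrite big_cons -hilo /weight; ring|]) => r r01; rewrite (cons_digit r r01) /cut.
  case: ltP => rp.
    by rewrite ler_pdivlMr// ltr_pdivrMr// ![_ * p]mulrC; split=> [[]|].
  by split=> [[]//|]; lra.
case: ltP => rp; first by split=> [[]//|]; lra.
rewrite ler_pdivlMr// ltr_pdivrMr// ![_ * (1 - p)]mulrC lerBrDl ltrBlDl.
by split=> [[]|].
Qed.

Lemma unit_lebesgue_cylinder (R : realType) (p : R) (bs : seq bool) : 0 < p < 1 ->
  @unit_lebesgue R [set r | forall k, (k < size bs)%N -> digit p k r = nth false bs k]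
  = (\prod_(b <- bs) weight p b)%:E.
Proof.
move=> p01; have [lo [hi [lo0 lohi hi1 <- H]]] := cylinder_itv bs p01.
rewrite /unit_lebesgue /mrestr (_ : _ `&` _ = `[lo, hi[%classic).
  rewrite lebesgue_measure_itv/= lte_fin EFinB; case: ltP => // hilo.
  by have -> : hi = lo; [lra|rewrite subee].
apply/seteqP; split=> r /=; rewrite !in_itv/=.
  by move=> [h r01]; exact/(H r r01).
by move=> h; have r01 : 0 <= r < 1 by [lra]; split=> //; exact/(H r r01).
Qed.

(** A free digit splits the event into two, whose weights add up to [p + (1 - p) = 1]. *)
Lemma unit_lebesgue_partial_cylinder (R : realType) (p : R) (f : nat -> option bool) N :
  0 < p < 1 ->
  @unit_lebesgue R [set r | forall k b, (k < N)%N -> f k = Some b -> digit p k r = b]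
  = (\prod_(k < N) (if f k is Some b then weight p b else 1))%:E.
Proof.
move=> p01.
(* [j] is the length of the final stretch on which [f] may still be [None]; the induction fills it
   from the left. *)
suff H j : (j <= N)%N -> forall f, (forall k, (k < N - j)%N -> f k != None) ->
    @unit_lebesgue R [set r | forall k b, (k < N)%N -> f k = Some b -> digit p k r = b]
    = (\prod_(k < N) (if f k is Some b then weight p b else 1))%:E.
  by apply: (H N) => // k; rewrite subnn.
elim: j => [|j IH] jN {}f fS.
  pose bs := mkseq (fun k => odflt false (f k)) N.
  have fk k : (k < N)%N -> f k = Some (nth false bs k).
    by move=> kN; rewrite nth_mkseq//; have := fS k; rewrite subn0 => /(_ kN); case: (f k).
  have := unit_lebesgue_cylinder bs p01; rewrite size_mkseq.
  rewrite (_ : [set r | _] = [set r | forall k b, (k < N)%N -> f k = Some b -> digit p k r = b]).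
    move=> ->; congr EFin; rewrite big_map -/(index_iota 0 N) -[in LHS](subn0 N).
    rewrite -/(index_iota 0 N) big_mkord; apply: eq_bigr => k _.
    by rewrite (fk k (ltn_ord k)) nth_mkseq//; case: (f k).
  apply/seteqP; split=> r /= h k.
    by move=> b kN; rewrite (fk k kN) => -[<-]; exact: h.
  by move=> kN; apply: h => //; exact: fk.
pose i := (N - j.+1)%N; have iN : (i < N)%N by rewrite /i; lia.
case fi : (f i) => [b|].
  apply: IH; first lia.
  move=> k kj; have [->|ki] := eqVneq k i; first by rewrite fi.
  by apply: fS; move: ki; rewrite /i; lia.
pose g b := fun k => if k == i then Some b else f k.
pose A b := [set r | forall k b', (k < N)%N -> g b k = Some b' -> digit p k r = b'].
have mA b : measurable (A b).
  rewrite (_ : A b = \bigcap_(k in [set k | (k < N)%N])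
     (if g b k is Some b' then [set r | digit p k r = b'] else setT)).
    by apply: bigcap_measurableType => k _; case: (g b k) => // b'; exact: measurable_digit.
  apply/seteqP; split=> r h k; first by move=> /= kN; case gk: (g b k) => //=; exact: h.
  by move=> b' kN gk; have := h k kN; rewrite gk.
have gA b : @unit_lebesgue R (A b) = (\prod_(k < N) (if g b k is Some b then weight p b else 1))%:E.
  apply: IH; first lia.
  move=> k kj; rewrite /g; have [//|ki] := eqVneq k i.
  by apply: fS; move: ki; rewrite /i; lia.
rewrite (_ : [set r | _] = A true `|` A false); last first.
  apply/seteqP; split=> r /=.
    move=> h; case di : (digit p i r); [left|right] => k b kN; rewrite /g;
      by case: eqP => [->[<-]//|_]; exact: h.
  move=> h k b kN fk; have ki : k != i by apply/eqP => ki; move: fk; rewrite ki fi.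
  by case: h => h; apply: h => //; rewrite /g (negbTE ki).
transitivity (@unit_lebesgue R (A true) + @unit_lebesgue R (A false))%E.
  apply: measureU; [exact: mA|exact: mA|].
  apply/seteqP; split=> // r [/(_ i true iN) h1 /(_ i false iN)].
  by rewrite h1 /g ?eqxx// => /(_ erefl).
have prodg b : \prod_(k < N) (if g b k is Some b then weight p b else 1) =
    weight p b * \prod_(k < N | k != Ordinal iN) (if f k is Some b then weight p b else 1).
  rewrite (bigD1 (Ordinal iN))//= {1}/g eqxx; congr (_ * _); apply: eq_bigr => k ki.
  by rewrite /g (_ : (k == i :> nat) = false)//; exact: negbTE ki.
rewrite !gA -EFinD; congr EFin; rewrite !prodg [RHS](bigD1 (Ordinal iN))//= fi mul1r.
by rewrite -mulrDl /weight addrC subrK mul1r.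
Qed.

Lemma unit_lebesgue_digits (R : realType) (p : R) (s : seq nat) (beta : nat -> bool) :
  0 < p < 1 -> uniq s ->
  @unit_lebesgue R [set r | forall k, k \in s -> digit p k r = beta k]
  = (\prod_(k <- s) weight p (beta k))%:E.
Proof.
move=> p01 us; pose N := (\max_(k <- s) k).+1.
have sN k : k \in s -> (k < N)%N by move=> ks; rewrite ltnS; exact: leq_bigmax_seq.
pose f k := if k \in s then Some (beta k) else None.
have := unit_lebesgue_partial_cylinder f N p01.
rewrite (_ : [set r | _] = [set r | forall k, k \in s -> digit p k r = beta k]).
  move=> ->; congr EFin.
  rewrite -(big_mkord xpredT (fun k => if f k is Some b then weight p b else 1)).
  rewrite (eq_bigr (fun k => if k \in s then weight p (beta k) else 1)); last first.
    by move=> k _; rewrite /f; case: ifP.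
  rewrite -big_mkcond -big_filter; apply: perm_big; apply: uniq_perm => //.
    exact/filter_uniq/iota_uniq.
  move=> k; rewrite mem_filter mem_index_iota /=.
  by case ks: (k \in s) => //=; exact: sN.
apply/seteqP; split=> r /= h k.
  by move=> ks; apply: h; [exact: sN|rewrite /f ks].
by move=> b kN; rewrite /f; case: ifP => // ks [<-]; exact: h.
Qed.

(** * Coding of edges by integers, and the product sigma-algebra *)

Lemma edge_endpoints (e : Edge) : exists xy : (int * int * bool) * (int * int * bool),
  proj1_sig e = pair_set xy.1 xy.2.
Proof. by case: e => S /= [x [y [_ ->]]]; exists (x, y). Qed.

Definition edge_code (e : Edge) : nat := pickle (projT1 (cid (edge_endpoints e))).

Lemma edge_eq (e e' : Edge) : proj1_sig e = proj1_sig e' -> e = e'.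
Proof.
case: e e' => [S hS] [S' hS'] /= SS'; subst S'.
by congr exist; exact: Prop_irrelevance.
Qed.

Lemma edge_code_inj : injective edge_code.
Proof.
move=> e e'; rewrite /edge_code => /(pcan_inj pickleK) ee'.
by apply: edge_eq; rewrite (projT2 (cid (edge_endpoints e))) ee' -(projT2 (cid (edge_endpoints e'))).
Qed.

Definition edge_decode (n : nat) : option Edge :=
  if pselect (exists e, edge_code e = n) is left h then Some (projT1 (cid h)) else None.

Lemma edge_codeK : pcancel edge_code edge_decode.
Proof.
move=> e; rewrite /edge_decode; case: pselect => [h|[]]; last by exists e.
by congr Some; apply: edge_code_inj; exact: (projT2 (cid h)).
Qed.

Lemma measurable_coord (e : Edge) (b : bool) : measurable ([set w | w e = b] : set Omega).
Proof. by apply: sub_sigma_algebra; exists e, b. Qed.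

Lemma measurable_coords (c : Edge -> Prop) (v : Edge -> bool) :
  measurable ([set w | forall e, c e -> w e = v e] : set Omega).
Proof.
rewrite (_ : [set w | _] = \bigcap_n [set w : Omega | forall e, edge_decode n = Some e ->
    c e -> w e = v e]).
  apply: bigcapT_measurable => n; case: (edge_decode n) => [e|].
    have [ce|nce] := pselect (c e).
      rewrite (_ : [set w | _] = [set w : Omega | w e = v e]); first exact: measurable_coord.
      by apply/seteqP; split=> w /= h; [exact: h|move=> e' [<-]].
    rewrite (_ : [set w | _] = setT); first exact: measurableT.
    by apply/seteqP; split=> w //= _ e' [<-].
  rewrite (_ : [set w | _] = setT); first exact: measurableT.
  by apply/seteqP; split=> w.
apply/seteqP; split=> w /= h; first by move=> n _ e _; exact: h.
by move=> e; apply: (h (edge_code e)) => //; rewrite edge_codeK.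
Qed.

Lemma measurable_to_Omega d (T : measurableType d) (f : T -> Omega) :
  (forall e b, measurable [set t | f t e = b]) -> measurable_fun setT f.
Proof.
move=> mf; apply: (@measurability _ _ T Omega setT f cylinders) => // _ [_ [e [b ->]] <-].
by rewrite setTI; exact: mf.
Qed.

Lemma pushforward_probability (R : realType) d d' (T : measurableType d)
  (T' : measurableType d') (mu : probability T R) (f : T -> T') :
  measurable_fun setT f ->
  exists P : probability T' R, forall A, P A = mu (f @^-1` A).
Proof. by move=> mf; exists (distribution mu (mfun_Sub (mem_set mf))). Qed.

Lemma mem_edge_codes (e : Edge) (es : seq Edge) :
  edge_code e \in map edge_code es <-> List.In e es.
Proof.
elim: es => //= e' es IH; rewrite in_cons; split=> [/orP[/eqP/edge_code_inj->|/IH]|[->|/IH]].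
- by left.
- by right.
- by rewrite eqxx.
- by move=> ->; rewrite orbT.
Qed.

(** Every edge reads its own digit of one uniform number, the one indexed by its code. *)
Lemma bernoulli_exists (R : realType) (p : R) : 0 < p < 1 ->
  exists Q : probability Omega R, bernoulli_product p Q.
Proof.
move=> p01; pose f (r : R) : Omega := fun e => digit p (edge_code e) r.
have mf : measurable_fun setT f.
  by apply: measurable_to_Omega => e b; exact: measurable_digit.
have [Q QE] := pushforward_probability (@unit_lebesgue R) mf.
exists Q => es b nd; rewrite QE.
pose beta n := if edge_decode n is Some e then b e else true.
have us : uniq (map edge_code es).
  by elim: nd => //= e l nl _ ->; rewrite andbT; apply/negP => /mem_edge_codes.
have := unit_lebesgue_digits beta p01 us; rewrite big_map.
under eq_bigr => e _ do rewrite /beta edge_codeK.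
move=> <-; congr unit_lebesgue; apply/seteqP; split=> r /= h.
  move=> k kes; have [e ke] : exists e, k = edge_code e.
    by elim: es kes {nd us h} => //= e es IH; rewrite in_cons => /orP[/eqP->|//]; exists e.
  by subst k; rewrite /beta edge_codeK; apply: h; exact/mem_edge_codes.
by move=> e /mem_edge_codes/h; rewrite /beta edge_codeK.
Qed.

(** * Counting closed edges in bad boxes *)

HB.instance Definition _ := gen_eqMixin Edge.

Lemma inP (T : eqType) (x : T) (s : seq T) : reflect (List.In x s) (x \in s).
Proof.
apply: (iffP idP); elim: s => //= y s IH.
  by rewrite in_cons => /orP[/eqP->|/IH]; [left|right].
by rewrite in_cons => -[->|/IH ->]; rewrite ?eqxx ?orbT.
Qed.

Lemma uniq_NoDup (T : eqType) (s : seq T) : uniq s -> List.NoDup s.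
Proof.
elim: s => [|x s IH] /=; first by constructor.
by move=> /andP[xs us]; constructor; [move=> /inP; exact/negP|exact: IH].
Qed.

Definition cells : seq (nat * nat) := [seq (i, j) | i <- iota 0 3, j <- iota 0 3].

Definition cell_pairs : seq ((nat * nat) * (nat * nat)) :=
  [seq c <- [seq (a, b) | a <- cells, b <- cells] | c.1 != c.2].

(* Every bad box of level [k] contains a list of [2 ^ k] distinct closed
   elements among these: a bad box has two bad sub-boxes. *)
Fixpoint bad_lists (E : eqType) (own : nat -> nat -> seq E) (k p q : nat) : seq (seq E) :=
  if k is k'.+1 then
    flatten [seq [seq l1 ++ l2
                   | l1 <- bad_lists own k' (3 * p + c.1.1) (3 * q + c.1.2),
                     l2 <- bad_lists own k' (3 * p + c.2.1) (3 * q + c.2.2)]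
            | c <- cell_pairs]
  else [seq [:: e] | e <- own p q].

Lemma bad_listsE (E : eqType) (own : nat -> nat -> seq E) k p q :
  bad_lists own k.+1 p q =
    flatten [seq [seq l1 ++ l2
                   | l1 <- bad_lists own k (3 * p + c.1.1) (3 * q + c.1.2),
                     l2 <- bad_lists own k (3 * p + c.2.1) (3 * q + c.2.2)]
            | c <- cell_pairs].
Proof. by []. Qed.

Section BadLists.
Variables (E : eqType) (own : nat -> nat -> seq E).
Hypothesis own_disj : forall p q p' q' e, e \in own p q -> e \in own p' q' -> (p, q) = (p', q').

Lemma bad_listsS k p q l : l \in bad_lists own k.+1 p q ->
  exists c l1 l2, [/\ c.1 != c.2 /\ [/\ c.1.1 < 3, c.1.2 < 3, c.2.1 < 3 & c.2.2 < 3]%N,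
    l1 \in bad_lists own k (3 * p + c.1.1) (3 * q + c.1.2),
    l2 \in bad_lists own k (3 * p + c.2.1) (3 * q + c.2.2) & l = l1 ++ l2].
Proof.
move=> /flattenP[_ /mapP[c cc ->]] /allpairsP[[l1 l2] /= [h1 h2 ->]].
exists c, l1, l2; split=> //; move: cc; rewrite mem_filter => /andP[-> /allpairsP[[a b] /=[ha hb ->]]].
move: ha hb => /allpairsP[[i j] /= [i3 j3 ->]] /allpairsP[[i' j'] /= [i3' j3' ->]] /=.
by rewrite !inE in i3 j3 i3' j3'; split=> //; split; lia.
Qed.

(** Listed elements are owned by nodes inside the box. With disjoint ownership, lists of distinct
    sub-boxes are therefore disjoint and their concatenation has no repetition. *)
Lemma bad_lists_own k p q l e : l \in bad_lists own k p q -> e \in l ->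
  exists a b, [/\ e \in own a b, a %/ 3 ^ k = p & b %/ 3 ^ k = q]%N.
Proof.
elim: k p q l => [|k IH] p q l.
  by move=> /mapP[e' e'o ->]; rewrite inE => /eqP->; exists p, q; rewrite expn0 !divn1.
move=> /bad_listsS[c [l1 [l2 [[_ [c1 c2 c3 c4]] /IH h1 /IH h2 ->]]]].
rewrite mem_cat => /orP[/h1|/h2] [a [b [eo ha hb]]]; exists a, b; split=> //;
  by rewrite expnSr divnMA ?ha ?hb mulnC divnMDl// divn_small ?addn0.
Qed.

Lemma bad_lists_uniq k p q l : l \in bad_lists own k p q -> uniq l /\ size l = (2 ^ k)%N.
Proof.
elim: k p q l => [|k IH] p q l.
  by move=> /mapP[e' e'o ->].
move=> /bad_listsS[c [l1 [l2 [[c12 [c1 c2 c3 c4]] h1 h2 ->]]]].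
have [u1 s1] := IH _ _ _ h1; have [u2 s2] := IH _ _ _ h2; split; last first.
  by rewrite size_cat s1 s2 expnS mul2n addnn.
rewrite cat_uniq u1 u2 andbT /=; apply/hasPn => e el2; apply/negP => el1.
have [a [b [eo ha hb]]] := bad_lists_own h1 el1.
have [a' [b' [eo' ha' hb']]] := bad_lists_own h2 el2.
have [aa bb] := own_disj eo eo'; subst a' b'.
move: c12 => /eqP; apply; case: c c1 c2 c3 c4 h1 h2 ha hb ha' hb' => -[i j] [i' j'] /=.
move=> *; congr pair; lia.
Qed.

(** At most 81 pairs of cells give the recursion [N (k+1) <= 81 * N k ^ 2]; the extra factor 81
    turns it into plain squaring. *)
Lemma bad_lists_size k p q K : (forall p q, size (own p q) <= K)%N ->
  (81 * size (bad_lists own k p q) <= (81 * K) ^ (2 ^ k))%N.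
Proof.
move=> hK; elim: k p q => [|k IH] p q.
  by rewrite [bad_lists _ _ _ _]/= size_map expn1 leq_mul2l hK.
set M := ((81 * K) ^ (2 ^ k))%N.
have -> : ((81 * K) ^ (2 ^ k.+1) = M * M)%N by rewrite expnS mul2n -addnn expnD.
rewrite bad_listsE size_flatten /shape -map_comp.
have len : (size cell_pairs <= 81)%N by [].
have : (forall c, c \in cell_pairs -> 81 * 81 * size [seq l1 ++ l2
                   | l1 <- bad_lists own k (3 * p + c.1.1) (3 * q + c.1.2),
                     l2 <- bad_lists own k (3 * p + c.2.1) (3 * q + c.2.2)] <= M * M)%N.
  by move=> c _; rewrite size_allpairs mulnACA leq_mul.
move: len; move: cell_pairs => cs len h.
suff : (81 * 81 * sumn [seq (size \o (fun c => [seq l1 ++ l2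
                   | l1 <- bad_lists own k (3 * p + c.1.1) (3 * q + c.1.2),
                     l2 <- bad_lists own k (3 * p + c.2.1) (3 * q + c.2.2)])) i | i <- cs]
     <= size cs * (M * M))%N.
  move=> H; have : (81 * 81 * sumn [seq (size \o (fun c => [seq l1 ++ l2
                   | l1 <- bad_lists own k (3 * p + c.1.1) (3 * q + c.1.2),
                     l2 <- bad_lists own k (3 * p + c.2.1) (3 * q + c.2.2)])) i | i <- cs] <= 81 * (M * M))%N.
    by apply: (leq_trans H); rewrite leq_mul2r len orbT.
  by rewrite -mulnA leq_pmul2l.
elim: cs {len} h => [|c cs IHc] h /=; first by rewrite muln0.
rewrite mulnDr mulSn; apply: leq_add; first by apply: h; rewrite inE eqxx.
by apply: IHc => c' c'cs; apply: h; rewrite inE c'cs orbT.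
Qed.

Lemma bad_lists_bad (eta : E -> bool) k p q :
  ~ gbox (fun a b => forall e, e \in own a b -> eta e) k p q ->
  exists2 l, l \in bad_lists own k p q & forall e, e \in l -> eta e = false.
Proof.
elim: k p q => [|k IH] p q.
  move=> /existsNP[e /not_implyP[eo ne]]; exists [:: e]; first exact: map_f.
  by move=> e'; rewrite inE => /eqP->; exact/negbTE/negP.
move=> /existsNP[i /existsNP[j /existsNP[i' /existsNP[j']]]].
move=> /not_implyP[i3 /not_implyP[j3 /not_implyP[i3' /not_implyP[j3' /not_implyP[ne]]]]].
move=> /not_orP[/IH[l1 h1 c1] /IH[l2 h2 c2]].
exists (l1 ++ l2); last by move=> e; rewrite mem_cat => /orP[/c1|/c2].
rewrite bad_listsE; apply/flattenP; exists [seq l1 ++ l2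
   | l1 <- bad_lists own k (3 * p + i) (3 * q + j), l2 <- bad_lists own k (3 * p + i') (3 * q + j')].
  apply/mapP; exists ((i, j), (i', j')) => //; rewrite mem_filter; apply/andP; split=> //.
  by apply/allpairsP; exists ((i, j), (i', j')); split=> //;
    apply/allpairsP; [exists (i, j)|exists (i', j')]; rewrite !mem_iota.
by apply/allpairsP; exists (l1, l2).
Qed.

End BadLists.

Lemma bernoulli_closed (R : realType) (eps : R) (Q : probability Omega R) (l : seq Edge) :
  bernoulli_product (1 - eps) Q -> uniq l ->
  Q [set w : Omega | forall e, e \in l -> w e = false] = (eps ^+ size l)%:E.
Proof.
move=> bQ ul; have := bQ l (fun=> false) (uniq_NoDup ul).
rewrite (_ : [set w : Omega | _] = [set w : Omega | forall e, e \in l -> w e = false]).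
  by move=> ->; rewrite big_const_seq iter_mulr_1 count_predT subKr.
by apply/seteqP; split=> w /= h e /inP; exact: h.
Qed.

Lemma measurable_closed (l : seq Edge) :
  measurable [set w : Omega | forall e, e \in l -> w e = false].
Proof. exact: (@measurable_coords (fun e => e \in l) (fun=> false)). Qed.

Lemma closed_lists (R : realType) (eps : R) (Q : probability Omega R) (ls : seq (seq Edge)) n :
  bernoulli_product (1 - eps) Q -> (forall l, l \in ls -> uniq l /\ size l = n) ->
  measurable [set w : Omega | exists2 l, l \in ls & forall e, e \in l -> w e = false] /\
  (Q [set w : Omega | exists2 l, l \in ls & forall e, e \in l -> w e = false]
    <= ((size ls)%:R * eps ^+ n)%:E)%E.
Proof.
move=> bQ; elim: ls => [|l ls IH] h.
  rewrite (_ : [set w | _] = set0); last by apply/seteqP; split=> w // [].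
  by rewrite measure0 mul0r.
have [ul sl] := h l (mem_head _ _).
have [|mS QS] := IH; first by move=> l' l'ls; apply: h; rewrite inE l'ls orbT.
rewrite (_ : [set w | _] = [set w : Omega | forall e, e \in l -> w e = false] `|`
    [set w : Omega | exists2 l, l \in ls & forall e, e \in l -> w e = false]).
  split; first by apply: measurableU => //; exact: measurable_closed.
  apply: (le_trans (measureU2 _ (measurable_closed l) mS)).
  have -> : (size (l :: ls))%:R * eps ^+ n = eps ^+ n + (size ls)%:R * eps ^+ n.
    by rewrite /= -natr1; ring.
  rewrite EFinD; apply: leeD QS.
  by rewrite -sl -(bernoulli_closed bQ ul).
apply/seteqP; split=> w /=.
  by move=> [l']; rewrite inE => /orP[/eqP->|l'ls] c; [left|right; exists l'].
by move=> [c|[l' l'ls c]]; [exists l; rewrite ?mem_head|exists l'; rewrite // inE l'ls orbT].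
Qed.

(** A union bound over the lists: level [k] fails with probability at most
    [(81 * K * eps) ^ (2 ^ k)], and these bounds sum to at most 1/2. *)
Lemma all_gbox_likely (R : realType) (own : nat -> nat -> seq Edge) (K : nat) :
  (0 < K)%N -> (forall p q, size (own p q) <= K)%N ->
  (forall p q p' q' e, e \in own p q -> e \in own p' q' -> (p, q) = (p', q')) ->
  exists eps : R, 0 < eps <= 1 /\ exists Q : probability Omega R,
    bernoulli_product (1 - eps) Q /\ exists H : set Omega,
    [/\ measurable H, (0 < Q H)%E &
     forall w, H w -> forall k, gbox (fun a b => forall e, e \in own a b -> w e) k 0 0].
Proof.
(* Since [324 = 4 * 81], this makes [81 * K * eps] equal to 1/4. *)
move=> K0 hK disj; pose eps : R := (324 * K)%:R^-1.
have K1 : 1 <= K%:R :> R by rewrite ler1n.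
have eps0 : 0 < eps by rewrite invr_gt0 ltr0n muln_gt0.
have eps1 : eps <= 324^-1 by rewrite lef_pV2 ?posrE ?ltr0n ?muln_gt0//; rewrite natrM ler_peMr.
exists eps; split; first by apply/andP; split => //; lra.
have [Q bQ] := @bernoulli_exists R (1 - eps) ltac:(lra).
exists Q; split=> //.
pose U k := [set w : Omega | exists2 l, l \in bad_lists own k 0 0 & forall e, e \in l -> w e = false].
have hU k := closed_lists bQ (@bad_lists_uniq _ own disj k 0 0).
have mU k : measurable (U k) by have [] := hU k.
have QU k : (Q (U k) <= ((1/2) / (2 ^ k.+1)%:R)%:E)%E.
  apply: (le_trans (proj2 (hU k))); rewrite lee_fin.
  have sz := @bad_lists_size _ own k 0 0 K hK.
  have e4 : (81 * K)%:R * eps = 4^-1 :> R.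
    have -> : eps = (4 * (81 * K)%:R)^-1 by rewrite /eps -natrM mulnA.
    by field; rewrite pnatr_eq0 -lt0n.
  apply: (@le_trans _ _ ((81 * K)%:R ^+ (2 ^ k) * eps ^+ (2 ^ k))).
    rewrite ler_pM2r ?exprn_gt0// -natrX ler_nat.
    by apply: leq_trans sz; rewrite leq_pmull.
  rewrite -exprMn e4 natrX exprS.
  have -> : 1 / 2 / (2 * 2 ^+ k) = 4^-1 * 2^-1 ^+ k :> R.
    by rewrite exprVn; field; rewrite expf_neq0 ?pnatr_eq0.
  (* As [k.+1 <= 2 ^ k], the doubly exponential bound is below a geometric one, in the form that
     [epsilon_trick0] sums. *)
  have kk : (k.+1 <= 2 ^ k)%N by exact: ltn_expl.
  apply: (@le_trans _ _ (4^-1 ^+ k.+1)).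
    by apply: ler_wiXn2l => //; lra.
  rewrite exprS ler_pM2l ?invr_gt0//; apply: lerXn2r; rewrite ?nnegrE; lra.
exists (~` (\bigcup_k U k)).
have mUU : measurable (\bigcup_k U k) by exact: bigcupT_measurable.
split; first exact: measurableC.
  rewrite probability_setC//.
  have : (Q (\bigcup_k U k) <= (1/2)%:E)%E.
    apply: (@le_trans _ _ (\sum_(k <oo) Q (U k))%E).
      exact: measure_sigma_subadditive.
    apply: (@le_trans _ _ (\sum_(k <oo) ((1/2) / (2 ^ k.+1)%:R)%:E)%E).
      by apply: lee_nneseries => // k _; exact: QU.
    by apply: epsilon_trick0; lra.
  move=> h; rewrite sube_gt0 (le_lt_trans h)// lte_fin; lra.
move=> w nU k; apply: contrapT => /bad_lists_bad[l hl cl].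
by apply: nU; exists k => //; exists l.
Qed.

(** * Measurability of infinite clusters *)

Lemma measurable_all d (T : measurableType d) (X : countType) (A : X -> set T) :
  (forall x, measurable (A x)) -> measurable [set t | forall x, A x t].
Proof.
move=> mA; rewrite (_ : [set t | _] =
    \bigcap_n (if unpickle n is Some x then A x else setT)).
  by apply: bigcapT_measurable => n; case: unpickle.
apply/seteqP; split=> t /= h; first by move=> n _; case: unpickle => //=.
by move=> x; have := h (pickle x) I; rewrite pickleK.
Qed.

Lemma measurable_ex d (T : measurableType d) (X : countType) (A : X -> set T) :
  (forall x, measurable (A x)) -> measurable [set t | exists x, A x t].
Proof.
move=> mA; rewrite (_ : [set t | _] =
    \bigcup_n (if unpickle n is Some x then A x else set0)).
  by apply: bigcupT_measurable => n; case: unpickle.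
apply/seteqP; split=> t /=; first by move=> [x Ax]; exists (pickle x) => //; rewrite pickleK.
by move=> [n _]; case: unpickle => //= x Ax; exists x.
Qed.

(** Infinitude in terms of countable quantifiers, for the sake of measurability. *)
Lemma infinite_pickleP (X : countType) (S : set X) :
  infinite_set S <-> forall n, exists y, (n <= pickle y)%N /\ S y.
Proof.
split=> [iS n|h fS].
  apply: contrapT => /forallNP h; apply: iS.
  apply: (@sub_finite_set _ _ (pickle @^-1` `I_n)).
    by move=> y Sy /=; rewrite ltnNge; apply/negP => ny; apply: (h y).
  apply: finite_preimage; last exact: finite_II.
  by move=> x y _ _; exact: (pcan_inj pickleK).
have /finite_seqP[s sE] := finite_image pickle fS.
have [y [ny Sy]] := h (\max_(k <- s) k).+1.
have : [set` s] (pickle y) by rewrite -sE; exists y.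
by move=> /= ys; have := @leq_bigmax_seq _ s xpredT id _ ys isT; rewrite leqNgt ny.
Qed.

(** Paths are graded by length so that connection becomes a countable union of measurable events. *)
Fixpoint open_steps (c : Edge -> bool) (n : nat) (x y : V) : Prop :=
  if n is n'.+1 then exists z : int * int * bool, open_adj c x z /\ open_steps c n' z y
  else x = y.

Lemma open_connected_steps c x y : open_connected c x y <-> exists n, open_steps c n x y.
Proof.
split=> [xy|[n]].
  have := Operators_Properties.clos_rt_rt1n _ _ _ _ xy; elim=> [z|z1 z2 z3 z12 _ [n h]]; first by exists 0.
  by exists n.+1, z2.
elim: n x => [|n IH] x /=; first by move=> ->; exact: Relation_Operators.rt_refl.
by move=> [z [xz /IH]]; apply: Relation_Operators.rt_trans; exact: Relation_Operators.rt_step.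
Qed.

Lemma measurable_open_steps (r : Edge -> bool) n x y :
  measurable [set eta : Omega | open_steps (fun e => r e && eta e) n x y].
Proof.
elim: n x => [|n IH] x /=.
  have [xy|xy] := pselect (x = y).
    rewrite [X in measurable X](_ : _ = setT); first exact: measurableT.
    by apply/seteqP; split.
  rewrite [X in measurable X](_ : _ = set0); first exact: measurable0.
  by apply/seteqP; split.
apply: measurable_ex => z; apply: measurableI; last exact: IH.
have [[e [re ez]]|nz] := pselect (exists e, r e /\ proj1_sig e = pair_set x z).
  rewrite [X in measurable X](_ : _ = [set eta : Omega | eta e = true]); first exact: measurable_coord.
  apply/seteqP; split=> eta /=; last by move=> ee; exists e; rewrite re ee.
  by move=> [e' [/andP[_ ee'] ez']]; rewrite (@edge_eq e e')// ez ez'.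
rewrite [X in measurable X](_ : _ = set0); first exact: measurable0.
by apply/seteqP; split=> eta //= [e [/andP[re _] ez]]; apply: nz; exists e.
Qed.

Lemma measurable_infinite_cluster (r : Edge -> bool) (C : set V) :
  measurable [set eta : Omega | exists x, C x /\
    infinite_set (cluster_of (fun e => r e && eta e) x)].
Proof.
pose A (x : int * int * bool) := [set eta : Omega | C x /\
    forall n, exists y : int * int * bool, (n <= pickle y)%N /\
      exists m, open_steps (fun e => r e && eta e) m x y].
rewrite [X in measurable X](_ : _ = [set eta | exists x, A x eta]).
  apply: measurable_ex => x; have [Cx|nCx] := pselect (C x).
    rewrite (_ : A x = [set eta : Omega | forall n, exists y : int * int * bool,
        (n <= pickle y)%N /\ exists m, open_steps (fun e => r e && eta e) m x y]); last first.
      by apply/seteqP; split=> eta; rewrite /A /=; tauto.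
    apply: measurable_all => n; apply: measurable_ex => y.
    have [ny|ny] := boolP (n <= pickle y)%N.
      rewrite [X in measurable X](_ : _ = [set eta : Omega | exists m, open_steps (fun e => r e && eta e) m x y]).
        by apply: measurable_ex => m; exact: measurable_open_steps.
      by apply/seteqP; split=> eta /= => [[]|].
    rewrite [X in measurable X](_ : _ = set0); first exact: measurable0.
    by apply/seteqP; split=> eta //= [].
  rewrite (_ : A x = set0); first exact: measurable0.
  by apply/seteqP; split=> eta //= [].
apply/seteqP; split=> eta /= [x [Cx]].
  move=> /(@infinite_pickleP (int * int * bool)%type) h; exists x; split=> // n.
  by have [y [ny /open_connected_steps xy]] := h n; exists y.
move=> h; exists x; split=> //; apply/(@infinite_pickleP (int * int * bool)%type) => n.
by have [y [ny /open_connected_steps xy]] := h n; exists y.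
Qed.

(** * Periodic grids *)

Definition mkedge (u v : V) (h : adj u v) : Edge :=
  exist _ (pair_set u v) (ex_intro _ u (ex_intro _ v (conj h erefl))).

Lemma adj_hor (a b : int) l : adj (a, b, l) (a + 1, b, l).
Proof. by left; split=> //; lia. Qed.

Lemma adj_ver (a b : int) l : adj (a, b, l) (a, b + 1, l).
Proof. by right; left; split=> //; lia. Qed.

Lemma adj_rung (a b : int) l : adj (a, b, l) (a, b, ~~ l).
Proof. by right; right; split=> //; case: l. Qed.

Definition hor a b l : Edge := mkedge (adj_hor a b l).
Definition ver a b l : Edge := mkedge (adj_ver a b l).
Definition rung a b l : Edge := mkedge (adj_rung a b l).

Lemma pair_set_eq (u v u' v' : V) : pair_set u v = pair_set u' v' ->
  (u = u' /\ v = v') \/ (u = v' /\ v = u').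
Proof.
move=> h.
have hu : pair_set u' v' u by rewrite -h; left.
have hv : pair_set u' v' v by rewrite -h; right.
have hu' : pair_set u v u' by rewrite h; left.
have hv' : pair_set u v v' by rewrite h; right.
case: hu hv hu' hv' => -> [->|->] [] ? [] ?; subst; tauto.
Qed.

Lemma open_connected_sym c x y : open_connected c x y -> open_connected c y x.
Proof.
elim=> [u v [e [ce euv]]|u|u v t _ h1 _ h2].
- apply: Relation_Operators.rt_step; exists e; split=> //; rewrite euv.
  by apply/seteqP; split=> s [->|->]; [right|left|right|left].
- exact: Relation_Operators.rt_refl.
- exact: Relation_Operators.rt_trans h2 h1.
Qed.

Lemma open_connected_trans c x y z :
  open_connected c x y -> open_connected c y z -> open_connected c x z.
Proof. exact: Relation_Operators.rt_trans. Qed.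

Lemma open_connected_edge (c : Edge -> bool) u v (h : adj u v) : c (mkedge h) -> open_connected c u v.
Proof. by move=> ch; apply: Relation_Operators.rt_step; exists (mkedge h). Qed.

(* The configurations in which layer [s] consists of the horizontal lines, the
   other layer of the vertical lines, and whose rungs at the columns [i + M Z]
   and at the rows [j + M Z] are those at the crossings of the two families. *)
Definition grid (w : Edge -> bool) (s : bool) (M : nat) (i j : int) : Prop :=
  [/\ forall a b l, w (hor a b l) = (l == s),
      forall a b l, w (ver a b l) = (l != s) &
      forall a b l, (M %| a - i)%Z || (M %| b - j)%Z ->
        w (rung a b l) = (M %| a - i)%Z && (M %| b - j)%Z].

Section Grid.
Variables (s : bool) (M : nat) (i j : int).
Hypothesis M0 : (0 < M)%N.

Definition node (p q : nat) (l : bool) : V := (i + (M * p)%N%:Z, j + (M * q)%N%:Z, l).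

(** A node owns its rung and the paths to its right and upper neighbours, so that no edge has two
    owners. *)
Definition node_edges (p q : nat) : seq Edge :=
  rung (i + (M * p)%N%:Z) (j + (M * q)%N%:Z) s ::
  [seq hor (i + (M * p + t)%N%:Z) (j + (M * q)%N%:Z) s | t <- iota 0 M] ++
  [seq ver (i + (M * p)%N%:Z) (j + (M * q + t)%N%:Z) (~~ s) | t <- iota 0 M].

Lemma size_node_edges p q : size (node_edges p q) = (M + M).+1.
Proof. by rewrite /= size_cat !size_map size_iota. Qed.

Lemma node_edgesP p q e : e \in node_edges p q ->
  [\/ e = rung (i + (M * p)%N%:Z) (j + (M * q)%N%:Z) s,
      exists2 t, (t < M)%N & e = hor (i + (M * p + t)%N%:Z) (j + (M * q)%N%:Z) s |
      exists2 t, (t < M)%N & e = ver (i + (M * p)%N%:Z) (j + (M * q + t)%N%:Z) (~~ s)].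
Proof.
rewrite in_cons mem_cat => /orP[/eqP->|/orP[]]; first by constructor 1.
  by move=> /mapP[t]; rewrite mem_iota => tM ->; constructor 2; exists t.
by move=> /mapP[t]; rewrite mem_iota => tM ->; constructor 3; exists t.
Qed.

Lemma euclid_eq p p' t t' : (t < M)%N -> (t' < M)%N -> (M * p + t = M * p' + t')%N -> p = p'.
Proof.
move=> tM t'M /(congr1 (fun n => n %/ M)%N).
by rewrite !(mulnC M) !divnMDl// !divn_small// !addn0.
Qed.

Lemma node_edges_disj p q p' q' e :
  e \in node_edges p q -> e \in node_edges p' q' -> (p, q) = (p', q').
Proof.
have eqM a b : (M * a)%N%:Z = (M * b)%N%:Z -> a = b.
  by move=> [ab]; apply: (@euclid_eq a b 0 0) => //; rewrite ab.
have eqMt a b t t' : (t < M)%N -> (t' < M)%N ->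
    (M * a + t)%N%:Z = (M * b + t')%N%:Z -> a = b.
  by move=> ? ? [ab]; exact: (euclid_eq _ _ ab).
case/node_edgesP => [->|[t tM ->]|[t tM ->]] /node_edgesP[|[t' tM' ]|[t' tM' ]]
  /(congr1 (@proj1_sig _ _))/= /pair_set_eq[] [[]].
all: try by case: (s).
- by move=> /addrI/eqM-> /addrI/eqM->.
- by move=> /addrI/eqMt-> // /addrI/eqM->.
- by move=> ? ? [? ?]; lia.
- by move=> /addrI/eqM-> /addrI/eqMt->.
- by move=> ? ? [? ?]; lia.
Qed.

Lemma node_connected (c : Edge -> bool) p q :
  (forall e, e \in node_edges p q -> c e) ->
  [/\ open_connected c (node p q s) (node p q (~~ s)),
      forall t, (t <= M)%N ->
        open_connected c (node p q s) (i + (M * p + t)%N%:Z, j + (M * q)%N%:Z, s) &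
      forall t, (t <= M)%N ->
        open_connected c (node p q (~~ s)) (i + (M * p)%N%:Z, j + (M * q + t)%N%:Z, ~~ s)].
Proof.
move=> ce; split.
- by apply: (@open_connected_edge c _ _ (adj_rung _ _ _)); apply: ce; rewrite inE eqxx.
- elim=> [|t IH] tM; first by rewrite addn0; exact: Relation_Operators.rt_refl.
  apply: (open_connected_trans (IH (ltnW tM))).
  have -> : i + (M * p + t.+1)%N%:Z = i + (M * p + t)%N%:Z + 1 by lia.
  apply: (@open_connected_edge c _ _ (adj_hor _ _ _)); apply: ce.
  rewrite in_cons mem_cat; apply/orP; right; apply/orP; left.
  by apply/mapP; exists t; rewrite ?mem_iota.
- elim=> [|t IH] tM; first by rewrite addn0; exact: Relation_Operators.rt_refl.
  apply: (open_connected_trans (IH (ltnW tM))).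
  have -> : j + (M * q + t.+1)%N%:Z = j + (M * q + t)%N%:Z + 1 by lia.
  apply: (@open_connected_edge c _ _ (adj_ver _ _ _)); apply: ce.
  rewrite in_cons mem_cat; apply/orP; right; apply/orP; right.
  by apply/mapP; exists t; rewrite ?mem_iota.
Qed.

Lemma node_connected_near (c : Edge -> bool) p q p' q' :
  (forall e, e \in node_edges p q -> c e) -> (forall e, e \in node_edges p' q' -> c e) ->
  near p q p' q' -> open_connected c (node p q s) (node p' q' s).
Proof.
move=> /node_connected[r h v] /node_connected[r' _ _] [] [? ?]; subst p' q'.
- exact: Relation_Operators.rt_refl.
- by rewrite /node mulnSr; exact: h.
(* The upward path runs in layer [~~ s], hence the rungs at both of its ends are used. *)
- apply: (open_connected_trans r); apply: open_connected_trans (open_connected_sym r').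
  by rewrite /node mulnSr; exact: v.
Qed.

(** Applied to the whole configuration, this places the owned edges inside the cluster, as
    [cluster_edges] demands. *)
Lemma node_edges_connected (c : Edge -> bool) p q e x :
  (forall e, e \in node_edges p q -> c e) -> e \in node_edges p q -> proj1_sig e x ->
  open_connected c (node p q s) x.
Proof.
move=> /node_connected[r h v] /node_edgesP[->|[t tM ->]|[t tM ->]] /= [->|->].
- exact: Relation_Operators.rt_refl.
- exact: r.
- exact/h/ltnW.
- have -> : i + (M * p + t)%N%:Z + 1 = i + (M * p + t.+1)%N%:Z by lia.
  exact: h.
- exact/(open_connected_trans r)/v/ltnW.
- have -> : j + (M * q + t)%N%:Z + 1 = j + (M * q + t.+1)%N%:Z by lia.
  exact/(open_connected_trans r)/v.
Qed.

Lemma grid_node_edges w p q e : grid w s M i j -> e \in node_edges p q -> w e.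
Proof.
move=> [hw vw rw] /node_edgesP[->|[t tM ->]|[t tM ->]].
- by rewrite rw !(addrC _ (_%:Z)) !addrK ?PoszM ?dvdz_mulr.
- by rewrite hw eqxx.
- by rewrite vw; case: (s).
Qed.

Lemma grid_node_connected w p q : grid w s M i j ->
  open_connected w (node 0 0 s) (node p q s).
Proof.
move=> gw; have ge a b e : e \in node_edges a b -> w e by exact: grid_node_edges.
elim: q => [|q IH].
  elim: p => [|p IH]; first exact: Relation_Operators.rt_refl.
  by apply: (open_connected_trans IH); apply: node_connected_near => //; [exact: ge|exact: ge|constructor 2].
by apply: (open_connected_trans IH); apply: node_connected_near => //; [exact: ge|exact: ge|constructor 3].
Qed.

(** With positive probability all boxes at the base node stay good under thinning, and then its
    thinned cluster is infinite. *)
Lemma grid_robust (R : realType) w : grid w s M i j ->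
  @robust R w (cluster_of w (node 0 0 s)).
Proof.
move=> gw; set C := cluster_of _ _.
have sz p q : (size (node_edges p q) <= (M + M).+1)%N by rewrite size_node_edges.
have [eps [eps01 [Q [bQ [H [mH QH hH]]]]]] := @all_gbox_likely R node_edges (M + M).+1 isT sz node_edges_disj.
exists eps; split=> //; exists Q; split=> //.
apply: (lt_le_trans QH); apply: le_measure; rewrite ?inE//.
  exact: measurable_infinite_cluster.
move=> eta /hH gk; exists (node 0 0 s); split; first exact: Relation_Operators.rt_refl.
set c := (fun e => _).
have cE p q e : e \in node_edges p q -> eta e -> c e.
  move=> eo ee; rewrite /c ee andbT /cluster_edges (grid_node_edges gw eo)/=.
  apply/asboolP => x ex; apply: (open_connected_trans (grid_node_connected p q gw)).
  by apply: (node_edges_connected _ eo ex) => e'; exact: grid_node_edges.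
have cnear p q p' q' : (forall e, e \in node_edges p q -> eta e) ->
    (forall e, e \in node_edges p' q' -> eta e) -> near p q p' q' ->
    open_connected c (node p q s) (node p' q' s).
  move=> g g'; apply: node_connected_near => e eo.
    by apply: (cE _ _ _ eo); exact: g.
  by apply: (cE _ _ _ eo); exact: g'.
have inf := @gbox_infinite _ (fun a b => open_connected c (node a.1 a.2 s) (node b.1 b.2 s))
  (fun a b => @open_connected_sym c _ _) (fun a b d => @open_connected_trans c _ _ _) cnear gk.
move=> fin.
(* The distance to the base node would be bounded on a finite cluster. *)
pose f (x : int * int * bool) := (`|x.1.1 - i| + `|x.1.2 - j|)%N.
have /finite_seqP[l lE] := finite_image f fin.
have [v [nv _ cv]] := inf (\max_(k <- l) k).+1.
have : [set` l] (f (node v.1 v.2 s)) by rewrite -lE; exists (node v.1 v.2 s).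
move=> /= vl; have := @leq_bigmax_seq _ l xpredT id _ vl isT.
rewrite leqNgt => /negP; apply; apply: (leq_trans nv).
rewrite /f /node /= !(addrC _ (_%:Z)) !addrK !absz_nat -mulnDr.
exact: leq_pmull.
Qed.

End Grid.

(** * Separation of the clusters of different colours *)

Lemma adj_sym u v : adj u v -> adj v u.
Proof.
case: u v => [[a b] l] [[c d] m] [[h1 h2 h3]|[[h1 h2 h3]|[h1 h2 h3]]].
- by left; split=> //; rewrite distrC.
- by right; left; split=> //; rewrite distrC.
- by right; right; split=> // ml; apply: h3.
Qed.

Lemma edge_adj (e : Edge) u v : proj1_sig e = pair_set u v -> adj u v.
Proof.
case: e => S [x [y [xy Sxy]]] /= SE; move: SE; rewrite Sxy => /pair_set_eq[][<- <-] //.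
exact: adj_sym.
Qed.

Lemma pair_setC (u v : V) : pair_set u v = pair_set v u.
Proof. by apply/seteqP; split=> t [->|->]; [right|left|right|left]. Qed.

(** No open edge leaves the selected rows of layer [s] and the selected columns of the other layer:
    a rung at one of these lines is open only at a crossing. *)
Lemma grid_closed w s M i j a b l c d m : grid w s M i j ->
  open_adj w (a, b, l) (c, d, m) ->
  (if l == s then (M %| b - j)%Z else (M %| a - i)%Z) ->
  (if m == s then (M %| d - j)%Z else (M %| c - i)%Z).
Proof.
move=> [hw vw rw] [e [we eE]] gl.
case: (edge_adj eE) => [[ac bd lm]|[[ac bd lm]|[ac bd lm]]]; subst.
- suff ls : m == s by rewrite ls in gl *.
  have [ca|ca] : (c = a + 1 \/ a = c + 1) by lia.
    by rewrite -(hw a d m) (_ : hor a d m = e)//; apply: edge_eq; rewrite eE ca.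
  by rewrite -(hw c d m) (_ : hor c d m = e)//; apply: edge_eq; rewrite eE ca pair_setC.
- suff ls : m != s by rewrite (negbTE ls) in gl *.
  have [ca|ca] : (d = b + 1 \/ b = d + 1) by lia.
    by rewrite -(vw c b m) (_ : ver c b m = e)//; apply: edge_eq; rewrite eE ca.
  by rewrite -(vw c d m) (_ : ver c d m = e)//; apply: edge_eq; rewrite eE ca pair_setC.
- have ml : m = ~~ l by case: l m lm {gl eE} => [] [].
  have : (M %| c - i)%Z || (M %| d - j)%Z by case: ifP gl => _ ->; rewrite ?orbT.
  move=> /(rw c d l); rewrite (_ : rung c d l = e); last by apply: edge_eq; rewrite eE ml.
  rewrite we => /esym/andP[h1 h2].
  by case: ifP.
Qed.

Lemma grid_cluster_sub w s M i j (x y : V) : grid w s M i j ->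
  open_connected w x y ->
  (if x.2 == s then (M %| x.1.2 - j)%Z else (M %| x.1.1 - i)%Z) ->
  (if y.2 == s then (M %| y.1.2 - j)%Z else (M %| y.1.1 - i)%Z).
Proof.
move=> gw; elim=> [[[a b] l] [[c d] m]|//|u v t _ h1 _ h2 /h1/h2//].
exact: grid_closed.
Qed.

(* A measurable event, almost sure for the process, on which there are infinitely
   many robust clusters. *)
Definition multigrid (w : Edge -> bool) : Prop :=
  exists s, forall k, exists i j, grid w s (2 ^ k.+1) i j.

(** Each level supplies one robust cluster, and clusters of different levels differ because their
    rows have different periods. *)
Lemma multigrid_infinite (R : realType) w : multigrid w ->
  infinite_set [set C : set V | is_cluster w C /\ @robust R w C].
Proof.
move=> [s gs].
have /choice[f hf] : forall k, exists ij : int * int, grid w s (2 ^ k.+1) ij.1 ij.2.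
  by move=> k; have [i [j g]] := gs k; exists (i, j).
pose x k := node (2 ^ k.+1) (f k).1 (f k).2 0 0 s.
pose C k := cluster_of w (x k).
move=> fin.
suff injC : injective C.
  have : finite_set (C @^-1` [set C | is_cluster w C /\ @robust R w C]).
    by apply: finite_preimage fin => k l _ _; exact: injC.
  rewrite (_ : _ @^-1` _ = setT); first exact: infinite_nat.
  apply/seteqP; split=> k // _; split; first by exists (x k).
  have M0 : (0 < 2 ^ k.+1)%N by rewrite expn_gt0.
  exact: (@grid_robust _ _ _ _ M0 R w (hf k)).
suff lt_neq k l : (k < l)%N -> C k <> C l.
  by move=> k l CC; case: (ltngtP k l) => // /lt_neq; rewrite CC.
move=> kl CC.
(* If the clusters agreed, the rows of level [k] would be among those of level [l]; two consecutive
   ones then give that [2 ^ l.+1] divides [2 ^ k.+1]. *)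
have dv q : ((2 ^ l.+1)%N%:Z %| (f k).2 + (2 ^ k.+1 * q)%N%:Z - (f l).2)%Z.
  have : C l (node (2 ^ k.+1) (f k).1 (f k).2 0 q s).
    by rewrite -CC; apply: grid_node_connected (hf k); rewrite expn_gt0.
  move=> /(grid_cluster_sub (hf l)) /=; rewrite eqxx muln0 addr0; apply.
  by rewrite subrr.
have := dv 0%N; have := dv 1%N; rewrite muln0 muln1 addr0 addrAC => h1 h0.
move: h1; rewrite (rpredDl _ h0).
rewrite dvdzE !absz_nat dvdn_Pexp2l//; lia.
Qed.

Lemma measurable_multigrid : measurable [set w : Omega | multigrid w].
Proof.
apply: measurable_ex => s; apply: measurable_all => k.
apply: measurable_ex => i; apply: measurable_ex => j.
rewrite [X in measurable X](_ : _ =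
   [set w : Omega | forall a b l, w (hor a b l) = (l == s)] `&`
   ([set w : Omega | forall a b l, w (ver a b l) = (l != s)] `&`
   [set w : Omega | forall a b l, ((2 ^ k.+1)%N%:Z %| a - i)%Z || ((2 ^ k.+1)%N%:Z %| b - j)%Z ->
        w (rung a b l) = ((2 ^ k.+1)%N%:Z %| a - i)%Z && ((2 ^ k.+1)%N%:Z %| b - j)%Z])).
  apply: measurableI.
    by do 3 (apply: measurable_all => ?); exact: measurable_coord.
  apply: measurableI.
    by do 3 (apply: measurable_all => ?); exact: measurable_coord.
  apply: measurable_all => a; apply: measurable_all => b; apply: measurable_all => l.
  case: (_ || _).
    rewrite [X in measurable X](_ : _ = [set w : Omega | w (rung a b l) =
      ((2 ^ k.+1)%N%:Z %| a - i)%Z && ((2 ^ k.+1)%N%:Z %| b - j)%Z]); first exact: measurable_coord.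
    by apply/seteqP; split=> w /= h; [exact: h|move=> _].
  rewrite [X in measurable X](_ : _ = setT); first exact: measurableT.
  by apply/seteqP; split.
by apply/seteqP; split=> w /= [h1]; [move=> h2 h3|move=> [h2 h3]].
Qed.

(** * Random residues *)

Definition residue (beta : nat -> bool) (n : nat) : nat := (\sum_(k < n) beta k * 2 ^ k)%N.

Lemma residueS beta n : residue beta n.+1 = (residue beta n + beta n * 2 ^ n)%N.
Proof. by rewrite /residue big_ord_recr. Qed.

Lemma residueSl beta n :
  residue beta n.+1 = (beta 0 + 2 * residue (fun k => beta k.+1) n)%N.
Proof.
rewrite /residue big_ord_recl expn0 muln1; congr (_ + _)%N.
by rewrite big_distrr; apply: eq_bigr => k _; rewrite /= mulnCA -expnS.
Qed.

Lemma residue_lt beta n : (residue beta n < 2 ^ n)%N.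
Proof.
elim: n => [|n IH]; first by rewrite /residue big_ord0.
by rewrite residueS expnS; case: (beta n); lia.
Qed.

Lemma residue_eqP beta n x : (x < 2 ^ n)%N ->
  residue beta n = x <-> forall k, (k < n)%N -> beta k = odd (x %/ 2 ^ k).
Proof.
elim: n beta x => [|n IH] beta x xn.
  by rewrite /residue big_ord0; split=> // _; move: xn; rewrite expn0; lia.
have xn2 : (x %/ 2 < 2 ^ n)%N by rewrite ltn_divLR// mulnC -expnS.
rewrite residueSl; split=> [xE k kn|h].
  have r2 : residue (fun k => beta k.+1) n = (x %/ 2)%N by rewrite -xE; case: (beta 0%N); lia.
  case: k kn => [|k] kn; first by rewrite expn0 divn1 -xE; case: (beta 0%N); lia.
  by rewrite expnS divnMA; move/(IH _ _ xn2): r2; apply.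
have -> : residue (fun k => beta k.+1) n = (x %/ 2)%N.
  by apply/(IH _ _ xn2) => k kn; rewrite h// expnS divnMA.
by rewrite (h 0%N)// expn0 divn1; case: (boolP (odd x)); lia.
Qed.

Section UniformLaw.
Context d (T : measurableType d) (R : realType) (mu : probability T R).
Variables (X : finType) (Z : T -> X) (h : R).
Hypothesis mZ : forall z, measurable [set t | Z t = z].
Hypothesis muZ : forall z, mu [set t | Z t = z] = h%:E.

Lemma measurable_finite_fun (psi : pred X) : measurable [set t | psi (Z t)].
Proof.
rewrite (_ : [set t | _] = [set t | exists z, (if psi z then [set t | Z t = z] else set0) t]).
  by apply: measurable_ex => z; case: ifP.
apply/seteqP; split=> t /=; first by move=> pt; exists (Z t); rewrite pt.
by move=> [z]; case: ifP => //= pz ->.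
Qed.

Lemma uniform_measure_seq (l : seq X) : uniq l ->
  mu [set t | Z t \in l] = ((size l)%:R * h)%:E.
Proof.
elim: l => [|z l IH] /=.
  by rewrite (_ : [set t | _] = set0) ?measure0 ?mul0r//; apply/seteqP; split.
move=> /andP[zl ul]; rewrite (_ : [set t | _] = [set t | Z t = z] `|` [set t | Z t \in l]).
  rewrite measureU//; last 2 first.
  - exact: (measurable_finite_fun (mem l)).
  - by apply/seteqP; split=> // t /= [->]; rewrite (negbTE zl).
  transitivity (h%:E + ((size l)%:R * h)%:E)%E; first by congr (_ + _)%E; [exact: muZ|exact: IH].
  by rewrite -EFinD -natr1; congr EFin; ring.
apply/seteqP; split=> t /=; rewrite inE; first by move=> /orP[/eqP|]; [left|right].
by move=> [->|->]; rewrite ?eqxx ?orbT.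
Qed.

(** An injection of a finite type is a permutation, so both predicates hold for equally many
    values. *)
Lemma uniform_invariant (tau : X -> X) (psi : pred X) : injective tau ->
  mu [set t | psi (tau (Z t))] = mu [set t | psi (Z t)].
Proof.
have E (phi : pred X) : mu [set t | phi (Z t)] = (#|phi|%:R * h)%:E.
  rewrite cardE -uniform_measure_seq ?enum_uniq//; congr (mu _).
  by apply/seteqP; split=> t /=; rewrite mem_enum.
move=> itau; rewrite (E (fun z => psi (tau z))) E; congr (_%:R * _)%:E.
by rewrite -!sum1_card [RHS](reindex_inj itau).
Qed.

End UniformLaw.

Definition coin (R : realType) (k : nat) (t : R) : bool := digit 2^-1 k t.

(** Odd bits shift the columns, positive even bits the rows, and bit 0 chooses the layer: three
    independent sources. *)
Definition xres (R : realType) (t : R) : nat -> nat := residue (fun k => coin k.*2.+1 t).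
Definition yres (R : realType) (t : R) : nat -> nat := residue (fun k => coin k.*2.+2 t).

Definition residues (R : realType) (N : nat) (t : R) : 'I_(2 ^ N) * 'I_(2 ^ N) * bool :=
  (Ordinal (residue_lt (fun k => coin k.*2.+1 t) N),
   Ordinal (residue_lt (fun k => coin k.*2.+2 t) N), coin 0 t).

Lemma residues_law (R : realType) N z :
  measurable [set t : R | residues N t = z] /\
  @unit_lebesgue R [set t | residues N t = z] = (2^-1 ^+ (N.*2.+1))%:E.
Proof.
case: z => [[x y] c].
have [dom [udom sdom domE]] : exists dom : seq nat,
    [/\ uniq dom, size dom = N.*2.+1 & forall k, (k \in dom) = (k < N.*2.+1)%N].
  exists (iota 0 N.*2.+1); split; [exact: iota_uniq|exact: size_iota|].
  by move=> k; rewrite mem_iota.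
(* [beta] interleaves the bits that the value [(x, y, c)] dictates, inverting the layout of the
   coins. *)
pose beta k := if k == 0%N then c else if odd k then odd (x %/ 2 ^ k./2)
  else odd (y %/ 2 ^ (k./2).-1).
have -> : [set t | residues N t = (x, y, c)] =
    [set t : R | forall k, k \in dom -> digit 2^-1 k t = beta k].
  apply/seteqP; split=> t /=.
    move=> [/(congr1 val)/(residue_eqP _ (ltn_ord x)) hx /(congr1 val)/(residue_eqP _ (ltn_ord y)) hy hc] k.
    rewrite domE => kN; rewrite /beta.
    case: eqP => [->//|k0]; case: ifP => ko.
      have kE : k = (k./2).*2.+1 by lia.
      by rewrite {1}kE; apply: hx; lia.
    have kE : k = ((k./2).-1).*2.+2 by lia.
    by rewrite {1}kE; apply: hy; lia.
  move=> h; congr ((_, _), _); last by rewrite /coin h// domE.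
    apply: val_inj; apply/(residue_eqP _ (ltn_ord x)) => k kN.
    rewrite /coin h ?domE; last lia.
    by rewrite /beta /= odd_double /= uphalf_double.
  apply: val_inj; apply/(residue_eqP _ (ltn_ord y)) => k kN.
  rewrite /coin h ?domE; last lia.
  by rewrite /beta /= odd_double /= doubleK.
split.
  rewrite (_ : [set t | _] = \bigcap_k [set t : R | k \in dom -> digit 2^-1 k t = beta k]).
    apply: bigcapT_measurable => k; case: (k \in _).
      rewrite (_ : [set t | _] = [set t : R | digit 2^-1 k t = beta k]); first exact: measurable_digit.
      by apply/seteqP; split=> t /= h; [exact: h|move=> _].
    rewrite (_ : [set t | _] = setT); first exact: measurableT.
    by apply/seteqP; split.
  by apply/seteqP; split=> t /= h; [move=> k _ /h|move=> k /(h k I)].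
rewrite unit_lebesgue_digits //; last by rewrite invr_gt0 ltr0n/=; lra.
rewrite (eq_bigr (fun=> 2^-1)); last by move=> k _; rewrite /weight; case: (beta k) => //; lra.
by rewrite big_const_seq iter_mulr_1 count_predT sdom.
Qed.

(** * The percolation process *)

(** Bits of index at least [n] contribute multiples of [2 ^ n]; the truncations are thus coherent
    and define a 2-adic integer. *)
Lemma residue_dvd beta n N (a : int) : (n <= N)%N ->
  ((2 ^ n)%N%:Z %| a + (residue beta N)%:Z)%Z = ((2 ^ n)%N%:Z %| a + (residue beta n)%:Z)%Z.
Proof.
elim: N => [|N IH]; first by rewrite leqn0 => /eqP->.
rewrite leq_eqVlt => /orP[/eqP->//|]; rewrite ltnS => nN.
rewrite residueS PoszD addrA rpredDr ?IH// dvdzE !absz_nat.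
exact/dvdn_mull/dvdn_exp2l.
Qed.

(** A condition on coordinates of endpoints rather than on kinds of edges, so that automorphisms act
    on it by substitution. [x] shifts columns, [y] shifts rows, and [s] is the layer of the
    horizontal lines. *)
Definition linked (n : nat) (x y : int) (s : bool) (u v : V) : Prop :=
  let: (a, b, l) := u in let: (c, d, m) := v in
  if l == m then (if l == s then b = d else a = c)
  else ((2 ^ n)%N%:Z %| a + x)%Z = ((2 ^ n)%N%:Z %| b + y)%Z.

Definition retained n x y s (e : Edge) : Prop :=
  forall u v, proj1_sig e u -> proj1_sig e v -> linked n x y s u v.

(* The bits [coin 2k+1] and [coin 2k+2] are the binary digits of two random
   2-adic integers; [retained n] asks that the column and the row of a rung
   agree on whether their 2-adic valuations, shifted by these integers, are at
   least [n]. *)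
Definition config (R : realType) (t : R) : Omega := fun e =>
  `[< forall n, retained n (xres t n) (yres t n) (coin 0 t) e >].

Lemma retained_residues (R : realType) (t : R) n N e : (n <= N)%N ->
  retained n (xres t n) (yres t n) (coin 0 t) e <->
  retained n (residues N t).1.1 (residues N t).1.2 (residues N t).2 e.
Proof.
move=> nN; split=> h [[a b] l] [[c d'] m] eu ev; have /= := h _ _ eu ev;
  by rewrite /xres /yres !(residue_dvd _ _ nN).
Qed.

Definition retained_upto (R : realType) (F : set Edge) (N : nat) : set R :=
  [set t | forall e n, F e -> (n <= N)%N -> retained n (xres t n) (yres t n) (coin 0 t) e].

Definition retained_mod (F : set Edge) (N : nat) (z : 'I_(2 ^ N) * 'I_(2 ^ N) * bool) : bool :=
  `[< forall e n, F e -> (n <= N)%N -> retained n z.1.1 z.1.2 z.2 e >].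

Lemma retained_uptoE (R : realType) (F : set Edge) N :
  retained_upto F N = [set t : R | retained_mod F (residues N t)].
Proof.
apply/seteqP; split=> t /=.
  by move=> h; apply/asboolP => e n Fe nN; apply/retained_residues => //; exact: h.
by move=> /asboolP h e n Fe nN; apply/(retained_residues _ _ nN); exact: h.
Qed.

Lemma measurable_retained (R : realType) (F : set Edge) N :
  measurable (@retained_upto R F N).
Proof.
rewrite retained_uptoE.
by apply: measurable_finite_fun => z; have [] := residues_law R z.
Qed.

Lemma measurable_config (R : realType) : measurable_fun setT (@config R).
Proof.
have mtrue e : measurable [set t : R | config t e = true].
  rewrite (_ : [set t | _] = [set t : R | forall N, retained_upto [set e] N t]).
    by apply: measurable_all => N; exact: measurable_retained.
  apply/seteqP; split=> t /=.
    by move=> /asboolP h N e' n -> _; exact: h.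
  by move=> h; apply/asboolP => n; apply: (h n) => //.
apply: measurable_to_Omega => e [|] //.
rewrite (_ : [set t | _] = ~` [set t : R | config t e = true]); first exact: measurableC.
by apply/seteqP; split=> t /=; [move=> ->|move/negP; exact: negbTE].
Qed.

(** Valuation exactly [k] is a single residue class modulo [2 ^ k.+1], which makes every colour
    class periodic. *)
Lemma dvdz_pow2_half k (z : int) :
  ((2 ^ k.+1)%N%:Z %| z - (2 ^ k)%N%:Z)%Z =
  ((2 ^ k)%N%:Z %| z)%Z && ~~ ((2 ^ k.+1)%N%:Z %| z)%Z.
Proof.
have p0 : (0 < (2 ^ k)%N%:Z :> int) by rewrite ltz_nat expn_gt0.
have -> : (2 ^ k.+1)%N%:Z = (2 ^ k)%N%:Z * 2 :> int by rewrite expnS PoszM mulrC.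
move: (2 ^ k)%N%:Z p0 => m m0.
have [/dvdzP[q ->]|nd] /= := boolP (m %| z)%Z.
  have -> : q * m - m = m * (q - 1) by ring.
  rewrite [q * m]mulrC !dvdz_mul2l; lia.
apply: contraNF nd => /dvdzP[q qE].
by apply/dvdzP; exists (2 * q + 1); lia.
Qed.

Lemma config_multigrid (R : realType) (t : R) : multigrid (config t).
Proof.
exists (coin 0 t) => k.
set s := coin 0 t.
(* A column and a row of colour [k]: after the shift both have coordinate [2 ^ k]. *)
exists ((2 ^ k)%N%:Z - (xres t k.+1)%:Z), ((2 ^ k)%N%:Z - (yres t k.+1)%:Z).
split.
- move=> a b l; apply/asboolP/idP => [/(_ 0%N (a, b, l) (a + 1, b, l))|/eqP-> n].
    move=> /(_ (or_introl erefl) (or_intror erefl)) /=; rewrite eqxx.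
    by case: ifP => //; lia.
  by move=> u v [->|->] [->|->] /=; rewrite !eqxx.
- move=> a b l; apply/asboolP/idP => [/(_ 0%N (a, b, l) (a, b + 1, l))|/negbTE ls n].
    move=> /(_ (or_introl erefl) (or_intror erefl)) /=; rewrite eqxx.
    by case: ifP => //; lia.
  by move=> u v [->|->] [->|->] /=; rewrite !eqxx ls.
move=> a b l.
pose D (r : nat -> nat) n (z : int) := ((2 ^ n)%N%:Z %| z + (r n)%:Z)%Z.
(* Together these facts say that on a line of colour [k] divisibility by [2 ^ n] holds exactly for
   [n <= k], so two such lines agree at every level. *)
have half r z : (forall n N (c : int), (n <= N)%N ->
      ((2 ^ n)%N%:Z %| c + (r N)%:Z)%Z = ((2 ^ n)%N%:Z %| c + (r n)%:Z)%Z) ->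
    [/\ ((2 ^ k.+1)%N%:Z %| z - ((2 ^ k)%N%:Z - (r k.+1)%:Z))%Z = D r k z && ~~ D r k.+1 z,
        forall n, (n <= k)%N -> D r k z -> D r n z &
        forall n, (k < n)%N -> D r n z -> D r k.+1 z].
  move=> hr; split.
  - rewrite (_ : z - _ = z + (r k.+1)%:Z - (2 ^ k)%N%:Z); last by lia.
    by rewrite dvdz_pow2_half /D (hr k k.+1).
  - by move=> n nk; rewrite /D -(hr n k)//; apply: dvdz_trans; rewrite dvdzE !absz_nat dvdn_exp2l.
  - by move=> n nk; rewrite /D -(hr k.+1 n)//; apply: dvdz_trans; rewrite dvdzE !absz_nat dvdn_exp2l.
have hx n N (c : int) := @residue_dvd (fun k => coin k.*2.+1 t) n N c.
have hy n N (c : int) := @residue_dvd (fun k => coin k.*2.+2 t) n N c.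
have [-> xle xge] := half (xres t) a hx.
have [-> yle yge] := half (yres t) b hy.
have rungE : config t (rung a b l) = `[< forall n, D (xres t) n a = D (yres t) n b >].
  apply: asbool_equiv_eq; split=> h n.
    have := h n (a, b, l) (a, b, ~~ l) (or_introl erefl) (or_intror erefl).
    by rewrite /= (_ : (l == ~~ l) = false)//; case: (l).
  move=> u v [->|->] [->|->] /=; rewrite ?eqxx; try by case: ifP.
    by rewrite (_ : (l == ~~ l) = false); [exact: h|case: (l)].
  by rewrite (_ : (~~ l == l) = false); [exact: h|case: (l)].
rewrite rungE => hab; apply/asboolP/idP => [h|/andP[/andP[x1 x2] /andP[y1 y2]] n].
  by move: hab; rewrite !h => /orP[]/andP[-> ->].
have [nk|nk] := leqP n k; first by rewrite xle// yle.
by rewrite (contraNF (xge n nk))// (contraNF (yge n nk)).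
Qed.

(** * Automorphisms of the slab *)

(* Two neighbours of a vertex without a second common neighbour: these turn
   out to be the opposite neighbours within a layer, so automorphisms map
   straight lines to straight lines. *)
Definition opposite (u v w : V) : Prop :=
  [/\ adj u v, adj u w, v <> w & forall z, adj z v -> adj z w -> z = u].

(** Neighbours in different directions span a square, whose fourth corner is a second common
    neighbour; and a vertex has only one rung. *)
Lemma opposite_midpoint (a b c d e f : int) (l m n : bool) :
  opposite (a, b, l) (c, d, m) (e, f, n) ->
  [/\ m = l, n = l, c + e = a + a & d + f = b + b].
Proof.
move=> [uv uw vw cn].
have nocn z : adj z (c, d, m) -> adj z (e, f, n) -> z <> (a, b, l) -> False.
  by move=> zv zw; apply; exact: cn.
case: (uv) => [[h1 h2 h3]|[[h1 h2 h3]|[h1 h2 h3]]];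
  case: (uw) => [[k1 k2 k3]|[[k1 k2 k3]|[k1 k2 k3]]]; subst.
- split=> //; have : c != e by [apply/eqP => ce; apply: vw; rewrite ce]; lia.
- exfalso; apply: (nocn (c, f, n)); [by right; left; split=> //; lia|
    by left; split=> //; lia|by case; lia].
- exfalso; apply: (nocn (c, f, n)); [by right; right; split=> // nm; apply: k3|
    by left; split=> //; lia|by case; lia].
- exfalso; apply: (nocn (e, d, n)); [by left; split=> //; lia|
    by right; left; split=> //; lia|by case; lia].
- split=> //; have : d != f by [apply/eqP => df; apply: vw; rewrite df]; lia.
- exfalso; apply: (nocn (e, d, n)); [by right; right; split=> // nm; apply: k3|
    by right; left; split=> //; lia|by case; lia].
- exfalso; apply: (nocn (e, f, m)); [by left; split=> //; lia|
    by right; right; split=> // nm; apply: h3|by case; lia].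
- exfalso; apply: (nocn (e, f, m)); [by right; left; split=> //; lia|
    by right; right; split=> // nm; apply: h3|by case; lia].
- by case: vw; congr (_, _, _); move: h3 k3; case: l m n {uv uw cn nocn} => [] [] [].
Qed.

Lemma opposite_hor (a b : int) l : opposite (a, b, l) (a - 1, b, l) (a + 1, b, l).
Proof.
split; [by left; split=> //; lia|by left; split=> //; lia|by move=> []; lia|].
move=> [[x y] k] [[h1 h2 h3]|[[h1 h2 h3]|[h1 h2 h3]]] [[k1 k2 k3]|[[k1 k2 k3]|[k1 k2 k3]]];
  subst; try lia.
by congr (_, _, _); lia.
Qed.

Lemma opposite_ver (a b : int) l : opposite (a, b, l) (a, b - 1, l) (a, b + 1, l).
Proof.
split; [by right; left; split=> //; lia|by right; left; split=> //; lia|by move=> []; lia|].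
move=> [[x y] k] [[h1 h2 h3]|[[h1 h2 h3]|[h1 h2 h3]]] [[k1 k2 k3]|[[k1 k2 k3]|[k1 k2 k3]]];
  subst; try lia.
by congr (_, _, _); lia.
Qed.

Lemma opposite_aut (f : aut) u v w : opposite u v w -> opposite (af f u) (af f v) (af f w).
Proof.
move=> [uv uw vw cn]; split; [exact/af_adj|exact/af_adj| |].
  by move=> /(can_inj (af_K f)).
by move=> z; rewrite -(ainv_K f z) => /af_adj zv /af_adj zw; rewrite (cn _ zv zw).
Qed.

Lemma affine_int (h : int -> int) : (forall n, h (n - 1) + h (n + 1) = h n + h n) ->
  forall n, h n = h 0 + n * (h 1 - h 0).
Proof.
move=> hh.
have pos (k : nat) : h k%:Z = h 0 + k%:Z * (h 1 - h 0) /\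
    h (k%:Z + 1) = h 0 + (k%:Z + 1) * (h 1 - h 0).
  elim: k => [|k [IH1 IH2]]; first by rewrite add0r; split; ring.
  rewrite -addn1 PoszD; split=> //; have := hh (k%:Z + 1).
  by rewrite addrK IH1 IH2 => h3; apply: (addrI (h 0 + k%:Z * (h 1 - h 0))); rewrite h3; ring.
have neg (k : nat) : h (- k%:Z) = h 0 - k%:Z * (h 1 - h 0) /\
    h (- k%:Z - 1) = h 0 - (k%:Z + 1) * (h 1 - h 0).
  elim: k => [|k [IH1 IH2]].
    rewrite oppr0 sub0r; split; first ring.
    have := hh 0; rewrite sub0r add0r => h3; apply: (addIr (h 1)); rewrite h3; ring.
  rewrite -addn1 PoszD opprD; split=> //; have := hh (- k%:Z - 1).
  by rewrite subrK IH1 IH2 => h3; apply: (addIr (h 0 - k%:Z * (h 1 - h 0))); rewrite h3; ring.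
move=> [k|k]; first by have [] := pos k.
by rewrite NegzE mulNr; have [] := neg k.+1.
Qed.

(** Affinity in each variable leaves a mixed term [a * b * D], which bounded steps exclude. *)
Lemma biaffine_int (h : int -> int -> int) :
  (forall a b, h (a - 1) b + h (a + 1) b = h a b + h a b) ->
  (forall a b, h a (b - 1) + h a (b + 1) = h a b + h a b) ->
  (forall a b, `|h (a + 1) b - h a b| <= 1) ->
  forall a b, h a b = h 0 0 + a * (h 1 0 - h 0 0) + b * (h 0 1 - h 0 0).
Proof.
move=> h1 h2 h3 a b.
pose D := h 1 1 - h 1 0 - h 0 1 + h 0 0.
have hE a' b' : h a' b' = h 0 0 + a' * (h 1 0 - h 0 0) + b' * (h 0 1 - h 0 0) + a' * b' * D.
  rewrite (@affine_int (fun a => h a b') (fun a => h1 a b') a').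
  rewrite (@affine_int (h 0) (h2 0) b') (@affine_int (h 1) (h2 1) b') /D; ring.
suff D0 : D = 0 by rewrite hE D0; ring.
have step b' : h 1 b' - h 0 b' = h 1 0 - h 0 0 + b' * D by rewrite (hE 1) (hE 0 b'); ring.
(* The step on row [b'] is [p + b' * D]; rows 0 and 3 give [|3 * D| <= 2], so the integer [D]
   vanishes. *)
have := h3 0 3; have := h3 0 0; rewrite add0r (step 3).
by clearbody D; move: (h 1 0 - h 0 0) => p; lia.
Qed.

(** Opposite neighbours go to opposite neighbours, so each layer is mapped into one layer by affine
    coordinates. Adjacency and injectivity then force signed unit vectors along the two axes. *)
Lemma aut_affine (f : aut) : exists t c s1 s2 (x y : int), forall a b l,
  af f (a, b, l) = ((if s1 then - (if t then b else a) else (if t then b else a)) + x,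
                    (if s2 then - (if t then a else b) else (if t then a else b)) + y,
                    l (+) c).
Proof.
pose F1 l a b := (af f (a, b, l)).1.1; pose F2 l a b := (af f (a, b, l)).1.2.
pose Fl l a b := (af f (a, b, l)).2.
have fE a b l : af f (a, b, l) = (F1 l a b, F2 l a b, Fl l a b).
  by rewrite /F1 /F2 /Fl; case: (af f _) => [[]].
have mh a b l := opposite_aut f (opposite_hor a b l).
have mv a b l := opposite_aut f (opposite_ver a b l).
have {}mh a b l : [/\ Fl l (a - 1) b = Fl l a b, Fl l (a + 1) b = Fl l a b,
   F1 l (a - 1) b + F1 l (a + 1) b = F1 l a b + F1 l a b &
   F2 l (a - 1) b + F2 l (a + 1) b = F2 l a b + F2 l a b].
  by have := mh a b l; rewrite !fE => /opposite_midpoint.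
have {}mv a b l : [/\ Fl l a (b - 1) = Fl l a b, Fl l a (b + 1) = Fl l a b,
   F1 l a (b - 1) + F1 l a (b + 1) = F1 l a b + F1 l a b &
   F2 l a (b - 1) + F2 l a (b + 1) = F2 l a b + F2 l a b].
  by have := mv a b l; rewrite !fE => /opposite_midpoint.
have lconst l a b : Fl l a b = Fl l 0 0.
  have up (g : int -> bool) : (forall n, g (n - 1) = g n) -> (forall n, g (n + 1) = g n) ->
      forall n, g n = g 0.
    move=> gd gu [k|k].
      by elim: k => // k IH; rewrite -addn1 PoszD gu.
    rewrite NegzE; elim: k.+1 => [|m IH]; first by rewrite oppr0.
    by rewrite -addn1 PoszD opprD gd.
  rewrite (up (fun a => Fl l a b)) => [|n|n]; try by have [] := mh n b l.
  by rewrite (up (fun b => Fl l 0 b)) => // n; have [] := mv 0 n l.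
have stepa l a b : (`|F1 l (a + 1) b - F1 l a b| + `|F2 l (a + 1) b - F2 l a b| = 1).
  have := proj2 (af_adj f (a, b, l) (a + 1, b, l)) (adj_hor a b l); rewrite !fE.
  by rewrite !lconst => -[[? ? _]|[[? ? _]|[]//]]; lia.
have stepb l a b : (`|F1 l a (b + 1) - F1 l a b| + `|F2 l a (b + 1) - F2 l a b| = 1).
  have := proj2 (af_adj f (a, b, l) (a, b + 1, l)) (adj_ver a b l); rewrite !fE.
  by rewrite !lconst => -[[? ? _]|[[? ? _]|[]//]]; lia.
have F1E l a b : F1 l a b = F1 l 0 0 + a * (F1 l 1 0 - F1 l 0 0) + b * (F1 l 0 1 - F1 l 0 0).
  apply: (@biaffine_int (F1 l)) => {}a {}b; [by have [] := mh a b l|by have [] := mv a b l|].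
  have := stepa l a b; lia.
have F2E l a b : F2 l a b = F2 l 0 0 + a * (F2 l 1 0 - F2 l 0 0) + b * (F2 l 0 1 - F2 l 0 0).
  apply: (@biaffine_int (F2 l)) => {}a {}b; [by have [] := mh a b l|by have [] := mv a b l|].
  have := stepa l a b; lia.
(* Surjectivity prevents both layers from landing in the same one. *)
have ldiff : Fl true 0 0 = ~~ Fl false 0 0.
  have := ainv_K f (0, 0, ~~ Fl false 0 0); case: (ainv f _) => [[a b] l]; rewrite fE lconst.
  by case: l => -[_ _ //]; case: (Fl false 0 0).
(* Rungs therefore go to rungs, and both layers share one planar map. *)
have same a b : F1 true a b = F1 false a b /\ F2 true a b = F2 false a b.
  have := proj2 (af_adj f (a, b, false) (a, b, true)) (adj_rung a b false); rewrite !fE.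
  by rewrite !lconst ldiff => -[[_ _]|[[_ _]|[-> ->]]]//; case: (Fl false 0 0).
have inj p q : af f p = af f q -> p = q by exact: (can_inj (af_K f)).
pose x := F1 false 0 0; pose y := F2 false 0 0.
pose b1 := F1 false 1 0 - x; pose b2 := F2 false 1 0 - y.
pose c1 := F1 false 0 1 - x; pose c2 := F2 false 0 1 - y.
have fE' a b l : af f (a, b, l) = (x + a * b1 + b * c1, y + a * b2 + b * c2, l (+) Fl false 0 0).
  rewrite fE lconst; case: l; last by rewrite F1E F2E addFb.
  by rewrite ldiff addTb; have [-> ->] := same a b; rewrite F1E F2E.
have sb : `|b1| + `|b2| = 1 by have := stepa false 0 0; rewrite add0r.
have sc : `|c1| + `|c2| = 1 by have := stepb false 0 0; rewrite add0r.
(* The images of the two unit vectors are neither equal nor opposite; having length 1, they lie on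
   different axes. *)
have bc : ~ (b1 = c1 /\ b2 = c2).
  move=> [h1 h2]; suff : (1, 0, false) = (0, 1, false) :> V by [].
  by apply: inj; rewrite !fE' h1 h2; congr (_, _, _); ring.
have bNc : ~ (b1 = - c1 /\ b2 = - c2).
  move=> [h1 h2]; suff : (1, 0, false) = (0, -1, false) :> V by [].
  by apply: inj; rewrite !fE' h1 h2; congr (_, _, _); ring.
clearbody b1 b2 c1 c2 x y.
have [b10|b10] := eqVneq b1 0.
  exists true, (Fl false 0 0), (c1 == -1), (b2 == -1), x, y => a b l; rewrite fE' b10.
  have -> : c2 = 0 by lia.
  congr (_, _, _); first by case: eqP => [->|c1n]; [ring|have -> : c1 = 1 by [lia]; ring].
  by case: eqP => [->|b2n]; [ring|have -> : b2 = 1 by [lia]; ring].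
exists false, (Fl false 0 0), (b1 == -1), (c2 == -1), x, y => a b l; rewrite fE'.
have -> : b2 = 0 by lia.
have -> : c1 = 0 by lia.
congr (_, _, _); first by case: eqP => [->|b1n]; [ring|have -> : b1 = 1 by [lia]; ring].
by case: eqP => [->|c2n]; [ring|have -> : c2 = 1 by [lia]; ring].
Qed.

(** * Invariance *)

Definition sg (b : bool) (z : int) : int := if b then - z else z.

(** Signs pass to the shifts because divisibility ignores them, exchanging the axes exchanges the
    shifts, and both this exchange and the layer swap toggle [s]. *)
Lemma linked_affine (t c s1 s2 : bool) (x y : int) n (X Y : int) s (g : V -> V) :
  (forall a b l, g (a, b, l) =
     (sg s1 (if t then b else a) + x, sg s2 (if t then a else b) + y, l (+) c)) ->
  forall u v, linked n X Y s (g u) (g v) <->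
    linked n (if t then sg s2 (y + Y) else sg s1 (x + X))
             (if t then sg s1 (x + X) else sg s2 (y + Y)) (s (+) c (+) t) u v.
Proof.
have sg_eq b z z' w : sg b z + w = sg b z' + w <-> z = z' by case: b; rewrite /sg; lia.
have sg_dvd b m (z w : int) : (m %| sg b z + w)%Z = (m %| z + sg b w)%Z.
  by case: b => //=; rewrite (_ : - z + w = - (z - w)) ?rpredN//; ring.
move=> gE [[a b] l] [[a' b'] l']; rewrite !gE /linked.
rewrite (_ : (l (+) c == l' (+) c) = (l == l')); last by case: l l' c {gE} => [] [] [].
rewrite (_ : (l (+) c == s) = (l == s (+) c)); last by case: l s c {gE} => [] [] [].
rewrite -!addrA !sg_dvd; case: t gE => _; rewrite ?addbT ?addbF.
  case: (l == l'); last by split=> ->.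
  rewrite (_ : (l == ~~ (s (+) c)) = ~~ (l == s (+) c)); last by case: l s c => [] [] [].
  by case: (l == _) => /=; rewrite sg_eq.
by case: (l == l') => //; case: (l == _); rewrite sg_eq.
Qed.

Lemma red_proof N (z : int) : (`|(z %% (2 ^ N)%N%:Z)%Z| < 2 ^ N)%N.
Proof.
rewrite -ltz_nat gez0_abs ?modz_ge0 ?ltz_pmod//; first by rewrite ltz_nat expn_gt0.
by rewrite eqz_nat -lt0n expn_gt0.
Qed.

Definition red N (z : int) : 'I_(2 ^ N) := Ordinal (red_proof N z).

Lemma red_dvd n N (a z : int) : (n <= N)%N ->
  ((2 ^ n)%N%:Z %| a + (red N z : nat)%:Z)%Z = ((2 ^ n)%N%:Z %| a + z)%Z.
Proof.
move=> nN.
have N0 : (2 ^ N)%N%:Z != 0 :> int by rewrite eqz_nat -lt0n expn_gt0.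
rewrite /= gez0_abs ?modz_ge0// [in RHS](divz_eq z (2 ^ N)%N%:Z) [in RHS]addrCA [RHS]rpredDl//.
by apply: dvdz_mull; rewrite dvdzE !absz_nat dvdn_exp2l.
Qed.

Lemma red_sg_inj N b (x : int) (i j : 'I_(2 ^ N)) :
  red N (sg b (x + i%:Z)) = red N (sg b (x + j%:Z)) -> i = j.
Proof.
move=> h.
have dz : ((2 ^ N)%N%:Z %| j%:Z - i%:Z)%Z.
  have := red_dvd (- sg b (x + i%:Z)) (sg b (x + j%:Z)) (leqnn N).
  rewrite -h red_dvd// addNr dvdz0 => /esym.
  case: b {h} => /=.
    by rewrite (_ : _ + _ = - (j%:Z - i%:Z)) ?rpredN//; lia.
  by rewrite (_ : _ + _ = j%:Z - i%:Z)//; lia.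
apply: val_inj => /=; apply/eqP; rewrite -eqz_nat eq_sym -subr_eq0; apply/negPn/negP => ne.
have := dvdn_leq _ dz; rewrite absz_gt0 ne absz_nat => /(_ isT).
by have := ltn_ord i; have := ltn_ord j; lia.
Qed.

Lemma retained_upto_edge_inv (R : realType) (f : aut) (F : set Edge) N :
  @unit_lebesgue R (retained_upto (edge_inv f @` F) N) =
  @unit_lebesgue R (retained_upto F N).
Proof.
(* [edge_inv] acts through the inverse, so the affine form is that of the inverse automorphism. *)
have [t [c [s1 [s2 [x [y gE]]]]]] := aut_affine (Aut (ainv_K f) (af_K f) (ainv_adj f)).
rewrite /= in gE.
pose I := 'I_(2 ^ N).
(* The permutation of residues and coin that [linked_affine] prescribes, reduced modulo [2 ^ N]. *)
pose tau (z : I * I * bool) : I * I * bool :=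
  (red N (if t then sg s2 (y + (z.1.2 : nat)%:Z) else sg s1 (x + (z.1.1 : nat)%:Z)),
   red N (if t then sg s1 (x + (z.1.1 : nat)%:Z) else sg s2 (y + (z.1.2 : nat)%:Z)),
   z.2 (+) c (+) t).
have tau_inj : injective tau.
  move=> [[i j] s] [[i' j'] s'] h.
  have h1 := congr1 (fun z => z.1.1) h; have h2 := congr1 (fun z => z.1.2) h.
  have /addIb/addIb /= -> := congr1 snd h; rewrite /tau /= in h1 h2.
  by case: t {tau gE h} h1 h2 => /red_sg_inj-> /red_sg_inj->.
have uni := @uniform_invariant _ _ R (@unit_lebesgue R) _ (@residues R N) (2^-1 ^+ N.*2.+1)
  (fun z => proj1 (residues_law R z)) (fun z => proj2 (residues_law R z)) tau
  (@retained_mod F N) tau_inj.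
rewrite [in RHS]retained_uptoE -uni retained_uptoE; congr unit_lebesgue.
have retE n X Y s e : (n <= N)%N -> retained n X Y s (edge_inv f e) <->
    retained n (red N (if t then sg s2 (y + Y) else sg s1 (x + X)))
      (red N (if t then sg s1 (x + X) else sg s2 (y + Y))) (s (+) c (+) t) e.
  move=> nN; have lin := linked_affine n X Y s gE.
  have redE X' Y' s' u v : linked n (red N X') (red N Y') s' u v <-> linked n X' Y' s' u v.
    by case: u v => [[a b] l] [[a' b'] l'] /=; rewrite !(red_dvd _ _ nN).
  split=> [h u v eu ev|h _ _ [u eu <-] [v ev <-]].
    by apply/redE/lin; apply: h; [exists u|exists v].
  by apply/lin/redE; exact: h.
apply/seteqP; split=> r /= /asboolP h; apply/asboolP.
  by move=> e n Fe nN; apply/(retE _ _ _ _ _ nN); apply: h => //; exists e.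
by move=> _ n [e Fe <-] nN; apply/(retE _ _ _ _ _ nN); exact: h.
Qed.

(** The truncated events decrease to the full one, so continuity from above applies. *)
Lemma retained_upto_cvg (R : realType) (F : set Edge) :
  (@unit_lebesgue R \o @retained_upto R F) @ \oo -->
    @unit_lebesgue R [set t | forall e, F e -> config t e].
Proof.
rewrite (_ : [set t | _] = \bigcap_N retained_upto F N).
  apply: nonincreasing_cvg_mu.
  - by rewrite -ge0_fin_numE ?fin_num_measure//; exact: measurable_retained.
  - by move=> N; exact: measurable_retained.
  - by apply: bigcapT_measurable => N; exact: measurable_retained.
  - by move=> m n mn; apply/subsetPset => t h e k Fe km; apply: h => //; exact: leq_trans mn.
apply/seteqP; split=> t /= h.
  by move=> N _ e n Fe _; have /asboolP := h e Fe; apply.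
by move=> e Fe; apply/asboolP => n; exact: (h n I).
Qed.

Lemma config_edge_inv (R : realType) (f : aut) (F : set Edge) :
  @unit_lebesgue R [set t | forall e, F e -> config t (edge_inv f e)] =
  @unit_lebesgue R [set t | forall e, F e -> config t e].
Proof.
have h := @retained_upto_cvg R (edge_inv f @` F).
rewrite (_ : [set t | _] = [set t : R | forall e, (edge_inv f @` F) e -> config t e]); last first.
  by apply/seteqP; split=> t /= H e; [move=> [e' Fe' <-]; exact: H|move=> Fe; apply: H; exists e].
apply: (cvg_unique _ h) => //.
rewrite (_ : _ \o _ = @unit_lebesgue R \o @retained_upto R F); first exact: retained_upto_cvg.
by apply/funext => N /=; exact: retained_upto_edge_inv.
Qed.

(** Events asking that all edges of a set be open are stable under intersection and generate the
    sigma-algebra. *)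
Lemma Omega_measure_unique (R : realType) (P P' : probability Omega R) :
  (forall F : set Edge, P [set w : Omega | forall e, F e -> w e] =
    P' [set w : Omega | forall e, F e -> w e]) ->
  forall A, measurable A -> P A = P' A.
Proof.
move=> PP' A mA.
pose G : set (set Omega) := [set B | exists F : set Edge, B = [set w : Omega | forall e, F e -> w e]].
have G_T : G setT by exists set0; apply/seteqP; split=> w // _ e [].
apply: (@g_sigma_algebra_measure_unique _ R Omega G _ (fun=> setT)) => //.
- by move=> _ [F ->]; exact: (@measurable_coords F (fun=> true)).
- by rewrite bigcup_const.
- move=> _ _ [F1 ->] [F2 ->]; exists (F1 `|` F2); apply/seteqP; split=> w /=.
    by move=> [h1 h2] e [/h1|/h2].
  by move=> h; split=> e Fe; apply: h; [left|right].
- by move=> _ [F ->]; exact: PP'.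
- by move=> _; rewrite -ge0_fin_numE// fin_num_measure.
apply: (smallest_sub _ _ mA); first exact: smallest_sigma_algebra.
have Ge e : <<s G >> [set w : Omega | w e = true].
  apply: sub_sigma_algebra; exists [set e]; apply/seteqP; split=> w /=; last exact.
  by move=> h e' ->.
move=> _ [e [[|] ->]] //.
rewrite (_ : [set w | _] = setT `\` [set w : Omega | w e = true]).
  exact: (sigma_algebraCD (Ge e)).
by apply/seteqP; split=> w /=; [move=> ->|case; case: (w e)].
Qed.

Theorem theorem1p1 (R : realType) :
  exists P : probability Omega R,
    aut_invariant P /\
    P.-negligible [set w : Omega |
      finite_set [set C : set V | is_cluster w C /\ @robust R w C]].
Proof.
have [P PE] := pushforward_probability (@unit_lebesgue R) (@measurable_config R).
exists P; split.
  move=> f A mA.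
  have mf : measurable_fun setT (aut_act f).
    by apply: measurable_to_Omega => e b; exact: measurable_coord.
  (* The law of the transformed configuration is compared with [P] on events that all edges of a set
     are open. *)
  have [P' P'E] := pushforward_probability P mf.
  rewrite -P'E; apply: Omega_measure_unique => // F.
  by rewrite P'E !PE; exact: config_edge_inv.
(* The complement of the measurable event [multigrid] is a null set, as every sample gives a
   multigrid, and it contains the exceptional configurations. *)
exists (~` [set w : Omega | multigrid w]); split.
- by apply: measurableC; exact: measurable_multigrid.
- rewrite PE (_ : _ @^-1` _ = set0) ?measure0//.
  by apply/seteqP; split=> t //=; apply; exact: config_multigrid.
- by move=> w /= fin mw; exact: (multigrid_infinite mw fin).
Qed.
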